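(* Let $q=e^{\pi i\tau}$ with $\mathrm{Im}(\tau)>0$ (so $0<|q|<1$). Then the following identities hold. (a) $\displaystyle \sum_{n=1}^{\infty}\frac{q^n}{(1-q^n)^2} - 2 \sum_{n=1}^{\infty}\frac{q^{2n}}{(1-q^{2n})^2} = \frac{1}{24}\left( \frac{\Pi_q^4}{\Pi_{q^2}^2}-1 \right) + \frac{2}{3}\Pi_{q^2}^2.$ (b) $\displaystyle \sum_{n=1}^{\infty}\frac{q^n}{(1-q^n)^2} - 3 \sum_{n=1}^{\infty}\frac{q^{3n}}{(1-q^{3n})^2} = \frac{(\Pi_q^2 + 3\Pi_{q^3}^2)^2}{12\,\Pi_q \Pi_{q^3}} - \frac{1}{12}.$ (c) $\displaystyle \sum_{n=1}^{\infty}\frac{q^n}{(1-q^n)^2} - 4 \sum_{n=1}^{\infty}\frac{q^{4n}}{(1-q^{4n})^2} = \frac{1}{8}\left( \frac{\Pi_q^4}{\Pi_{q^2}^2}-1\right).$ (d) $\displaystyle \sum_{n=1}^{\infty}\frac{q^{2n}}{(1-q^{2n})^2} - 9 \sum_{n=1}^{\infty}\frac{q^{18n}}{(1-q^{18n})^2} = \frac{\Pi_{q^3}^3}{\Pi_{q}} + \frac{1}{3}\left( \frac{\Pi_{q^3}^3}{\Pi_{q^9}}-1 \right).$ (e) $\displaystyle \sum_{n=1}^{\infty}\frac{q^{2n-1}}{(1-q^{2n-1})^2} - 3 \sum_{n=1}^{\infty}\frac{q^{6n-3}}{(1-q^{6n-3})^2} = \Pi_{q^3}\Pi_{q}.$ (f)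 $\displaystyle 6 \sum_{n=1}^{\infty}\frac{q^{4n-2}}{(1-q^{2n-1})^4} + \sum_{n=1}^{\infty}\frac{q^{2n-1}}{(1-q^{2n-1})^2} = \Pi_q^4.$
   Context: For complex $a$ and $|q|<1$, $(a;q)_\infty=\prod_{i=0}^{\infty}(1-aq^i)$. Ramanujan's theta function is $\psi(q)=\dfrac{(q^2;q^2)_\infty}{(q;q^2)_\infty}$. Gosper's $q$-constant is $\Pi_q = q^{1/4}\dfrac{(q^2;q^2)_\infty^2}{(q;q^2)_\infty^2}=q^{1/4}\psi^2(q)$. Powers of $q=e^{\pi i\tau}$ are understood as $q^{a}=e^{\pi i\tau a}$; thus for a positive integer $k$, $\Pi_{q^k}=q^{k/4}\psi^2(q^k)$ with $q^{k/4}=e^{\pi i\tau k/4}$. *)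

(* Defs.v *)
From Stdlib Require Export Reals.
From Coquelicot Require Export Coquelicot.
From Stdlib Require Import Lra Lia.

Open Scope C_scope.

(* The limit of a complex sequence, as a total function.  On divergent
   sequences the value is meaningless; see [Clim_correct], [qpoch_cvg] and
   [ex_series_lambert]. *)
Definition Clim (u : nat -> C) : C :=
  (real (Lim_seq (fun n => Re (u n))), real (Lim_seq (fun n => Im (u n)))).

(* Sum of [f n] over n >= 1: the term [f 0] is not included. *)
Definition Csum1 (f : nat -> C) : C := Clim (fun N => sum_n_m f 1 N).

Fixpoint qpoch (a q : C) (n : nat) : C :=
  match n with
  | O => 1
  | S m => qpoch a q m * (1 - a * q ^ m)
  end.

Definition qpoch_inf (a q : C) : C := Clim (qpoch a q).

Definition psi (q : C) : C := qpoch_inf (q ^ 2) (q ^ 2) / qpoch_inf q (q ^ 2).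

Definition cexp (z : C) : C :=
  (exp (Re z) * cos (Im z), exp (Re z) * sin (Im z))%R.

(* q^a for a real exponent a, where q = exp (pi i tau); the branch is the one
   determined by tau, not by q. *)
Definition qpow (tau : C) (a : R) : C := cexp (PI * Ci * tau * a).

Definition nome (tau : C) : C := cexp (PI * Ci * tau).

(* Gosper's constant Pi_{q^k} for q = nome tau.  It depends on tau and not only
   on q, because of the factor q^{k/4}. *)
Definition GosperPi (tau : C) (k : nat) : C :=
  qpow tau (INR k / 4) * psi (nome tau ^ k) ^ 2.

Lemma Clim_correct (u : nat -> C) (l : C) :
  filterlim u eventually (locally l) -> Clim u = l.
Proof.
  intros H. destruct l as [x y]. unfold Clim. f_equal.
  - rewrite (is_lim_seq_unique _ x); [reflexivity|].
    apply (filterlim_comp _ _ _ u fst _ (locally (x, y)) _ H).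
    intros P [e He]. exists e. intros z [Hz _]. exact (He _ Hz).
  - rewrite (is_lim_seq_unique _ y); [reflexivity|].
    apply (filterlim_comp _ _ _ u snd _ (locally (x, y)) _ H).
    intros P [e He]. exists e. intros z [_ Hz]. exact (He _ Hz).
Qed.

Lemma Csum1_correct (f : nat -> C) (l : C) :
  is_series (fun n => f (S n)) l -> Csum1 f = l.
Proof.
  intros H. apply Clim_correct.
  apply filterlim_ext_loc with (fun N => sum_n (fun n => f (S n)) (pred N)).
  - exists 1%nat. intros [|n] Hn; [lia|].
    unfold sum_n. rewrite <- sum_n_m_S. reflexivity.
  - apply (filterlim_comp _ _ _ pred _ _ eventually); [|exact H].
    intros P [N HN]. exists (S N). intros n Hn. apply HN. lia.
Qed.

Lemma nome_Cmod_lt_1 (tau : C) : (0 < Im tau)%R -> (Cmod (nome tau) < 1)%R.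
Proof.
  intros H. unfold nome, cexp, Cmod. cbn [fst snd].
  set (z := PI * Ci * tau).
  replace ((exp (Re z) * cos (Im z)) ^ 2 + (exp (Re z) * sin (Im z)) ^ 2)%R
    with (Rsqr (exp (Re z)) * (Rsqr (sin (Im z)) + Rsqr (cos (Im z))))%R
    by (unfold Rsqr; ring).
  rewrite sin2_cos2, Rmult_1_r, sqrt_Rsqr by (left; apply exp_pos).
  rewrite <- exp_0. apply exp_increasing.
  replace (Re z) with (- (PI * Im tau))%R
    by (unfold z, Re, Im; simpl; ring).
  assert (0 < PI * Im tau)%R by (apply Rmult_lt_0_compat; [apply PI_RGT_0|exact H]).
  lra.
Qed.

(* With [Csum1_correct], this makes every Lambert series over n >= 1, in powers
   of q = nome tau, a genuine sum: take g, h of the form n |-> k * S n - j. *)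
Lemma ex_series_lambert (q : C) (g h : nat -> nat) (p : nat) :
  (Cmod q < 1)%R -> (forall n, 1 <= g n)%nat -> (forall n, n <= h n)%nat ->
  ex_series (fun n => q ^ h n / (1 - q ^ g n) ^ p).
Proof.
  intros Hq Hg Hh.
  assert (H0 := Cmod_ge_0 q).
  assert (Hle : forall m n, (m <= n)%nat -> (Cmod q ^ n <= Cmod q ^ m)%R).
  { intros m n Hmn. replace n with (m + (n - m))%nat by lia. rewrite pow_add.
    rewrite <- (Rmult_1_r (Cmod q ^ m)) at 2.
    apply Rmult_le_compat_l; [apply pow_le; lra|].
    rewrite <- (pow1 (n - m)). apply pow_incr. lra. }
  apply (ex_series_le (K := C_AbsRing) (V := C_CompleteNormedModule) _
    (fun n => / (1 - Cmod q) ^ p * Cmod q ^ n)%R).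
  2:{ apply (ex_series_scal_l (/ (1 - Cmod q) ^ p)%R (fun n => Cmod q ^ n)%R).
      apply ex_series_geom. rewrite Rabs_pos_eq; lra. }
  intros n. change norm with Cmod.
  assert (Hd : (1 - Cmod q <= Cmod (1 - q ^ g n))%R).
  { assert (Ht := Cmod_triangle (1 - q ^ g n) (q ^ g n)).
    replace (1 - q ^ g n + q ^ g n) with (RtoC 1) in Ht by ring.
    rewrite Cmod_1, Cmod_pow in Ht.
    assert (H1 := Hle _ _ (Hg n)). rewrite pow_1 in H1. lra. }
  assert (Hnz : (1 - q ^ g n) ^ p <> 0).
  { apply Cpow_nz. intros E. rewrite E, Cmod_0 in Hd. lra. }
  rewrite Cmod_div by exact Hnz. rewrite !Cmod_pow. unfold Rdiv.
  rewrite Rmult_comm. apply Rmult_le_compat.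
  - left. apply Rinv_0_lt_compat, pow_lt. lra.
  - apply pow_le; lra.
  - apply Rinv_le_contravar; [apply pow_lt; lra|]. apply pow_incr. lra.
  - apply Hle, Hh.
Qed.

Lemma qpoch_cvg (a q : C) : (Cmod q < 1)%R ->
  filterlim (qpoch a q) eventually (locally (qpoch_inf a q)).
Proof.
  intros Hq. assert (H0 := Cmod_ge_0 q). assert (Ha := Cmod_ge_0 a).
  set (b := fun n => exp (Cmod a * sum_f_R0 (fun k => Cmod q ^ k) n)%R).
  assert (Hb : forall n, (Cmod (qpoch a q (S n)) <= b n)%R).
  { assert (Hstep : forall n, (Cmod (1 - a * q ^ n) <= exp (Cmod a * Cmod q ^ n))%R).
    { intros n. eapply Rle_trans; [apply Cmod_triangle|].
      rewrite Cmod_opp, Cmod_1, Cmod_mult, Cmod_pow. apply exp_ineq1_le. }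
    induction n as [|n IH].
    - unfold b. simpl sum_f_R0. change (qpoch a q 1) with (1 * (1 - a * q ^ 0)).
      rewrite Cmult_1_l. exact (Hstep 0%nat).
    - change (qpoch a q (S (S n))) with (qpoch a q (S n) * (1 - a * q ^ S n)).
      rewrite Cmod_mult. unfold b. rewrite tech5, Rmult_plus_distr_l, exp_plus.
      apply Rmult_le_compat; auto using Cmod_ge_0. }
  set (M := exp (Cmod a * / (1 - Cmod q))%R).
  assert (HM : forall n, (Cmod (qpoch a q n) <= M)%R).
  { assert (HMb : forall n, (b n <= M)%R).
    { intros n. unfold b, M.
      destruct (Req_dec (Cmod a) 0) as [-> | Hna]; [rewrite !Rmult_0_l; lra|].
      assert (Hs : (sum_f_R0 (fun k => Cmod q ^ k) n <= / (1 - Cmod q))%R).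
      { rewrite tech3 by lra. unfold Rdiv.
        rewrite <- (Rmult_1_l (/ (1 - Cmod q))) at 2.
        apply Rmult_le_compat_r; [left; apply Rinv_0_lt_compat; lra|].
        assert (0 <= Cmod q ^ S n)%R by (apply pow_le; lra). lra. }
      apply Rmult_le_compat_l with (r := Cmod a) in Hs; [|exact Ha].
      destruct Hs as [Hs | ->]; [left; apply exp_increasing, Hs|right; reflexivity]. }
    intros [|n]; [|eapply Rle_trans; [apply Hb|apply HMb]].
    simpl. rewrite Cmod_1, <- exp_0. unfold M.
    assert (Hp : (0 <= Cmod a * / (1 - Cmod q))%R).
    { apply Rmult_le_pos; [exact Ha|left; apply Rinv_0_lt_compat; lra]. }
    destruct Hp as [H | H].
    - left. apply exp_increasing, H.
    - right. f_equal. exact H. }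
  assert (Hex : ex_series (fun n => qpoch a q (S n) - qpoch a q n)).
  { apply (ex_series_le (K := C_AbsRing) (V := C_CompleteNormedModule) _
      (fun n => M * Cmod a * Cmod q ^ n)%R).
    2:{ apply (ex_series_scal_l (M * Cmod a)%R (fun n => Cmod q ^ n)%R).
        apply ex_series_geom. rewrite Rabs_pos_eq; lra. }
    intros n. change norm with Cmod.
    replace (qpoch a q (S n) - qpoch a q n) with (- (qpoch a q n * (a * q ^ n)))
      by (simpl; ring).
    rewrite Cmod_opp, !Cmod_mult, Cmod_pow, Rmult_assoc.
    apply Rmult_le_compat_r; [|apply HM].
    apply Rmult_le_pos; [exact Ha|apply pow_le; lra]. }
  destruct Hex as [s Hs].
  assert (Hlim : filterlim (qpoch a q) eventually (locally (1 + s))).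
  { apply filterlim_ext_loc with
      (fun n => plus (RtoC 1) (sum_n (fun n => qpoch a q (S n) - qpoch a q n) (pred n))).
    - exists 1%nat. intros [|n] Hn; [lia|]. clear Hn. simpl pred.
      induction n as [|n IH].
      + rewrite sum_O. change plus with Cplus. simpl. ring.
      + rewrite sum_Sn, plus_assoc, IH.
        change (qpoch a q (S n) + (qpoch a q (S (S n)) - qpoch a q (S n))
                = qpoch a q (S (S n))). ring.
    - apply (filterlim_comp_2 (F := eventually) (G := locally (RtoC 1)) (H := locally s)).
      + apply filterlim_const.
      + apply (filterlim_comp _ _ _ pred _ _ eventually); [|exact Hs].
        intros P [N HN]. exists (S N). intros n Hn. apply HN. lia.
      + exact (filterlim_plus (K := C_AbsRing) (V := C_NormedModule) (RtoC 1) s). }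
  unfold qpoch_inf. rewrite (Clim_correct _ _ Hlim). exact Hlim.
Qed.

(* Main.v *)
From Stdlib Require Import ZArith Lra Lia.
Require Import Defs.
Open Scope C_scope.

(** All six identities come from one formula for the elliptic function

      F_p(x) = sum over z in Z of lam (x p^z),   lam x = x / (1 - x)^2,

    which is, up to constants, the Weierstrass function written in the exponential variable.
    With theta_p(x) = (x;p)(p/x;p), the addition formula ([lam_sum_difference]) reads

      F_p(x) - F_p(y) = x theta_p(y/x) theta_p(xy) (p;p)^4 / (theta_p(x)^2 theta_p(y)^2).

    When x and y are torsion points, each value of F_p is a combination of Lambert series, by
    the symmetry lam (1/x) = lam x and the summation of lam over the square or cube roots of
    unity, and the theta values are infinite products which assemble into values of psi:
    - p = q^2, x = q and y = -1 give (c) ([lambert_level_four]), and (a) once combined with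
      y = -q ([lambert_level_two]);
    - p = q^6, x = q, y = q^3 give (e) ([lambert_odd_cubic]);
    - p = q^2, x = q, y a primitive cube root of unity ([lambert_level_six]), and p = q^6,
      x = q^2, y = q^3 ([lambert_cubic]): the square in (b), once expanded, is a combination of
      these two products and of the one in (e), and (d) combines the first of them at q^3 with
      the second at q;
    - p = q^2, y = q, x = qt: both sides vanish to second order as t tends to 1, and their
      leading coefficients give (f) ([second_derivative_half]).

    The addition formula comes from rearranging a double series.  The partial fraction
    expansion of a quotient of finite products ([qpoch_partial_fractions]) becomes, by
    dominated convergence, the sum of Kronecker

      K(x,y) = sum over z of x^z / (1 - y p^z) = (p;p)^2 theta_p(xy) / (theta_p(x) theta_p(y)).

    The product K(x,y) K(p/x,y) is a double sum; along a diagonal m - n = d with d nonzero it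
    telescopes to a multiple of 1/y whose factor is free of y, and the diagonal d = 0 gives
    F_p(y)/y.  So F_p(y) - y K(x,y) K(p/x,y) depends on x alone; at y = x the product vanishes
    because theta_p(1) = 0, hence this quantity is F_p(x) ([kron_product]). *)

(** * Limits of complex sequences *)

Definition tends (u : nat -> C) (l : C) : Prop :=
  filterlim u eventually (locally l).

(** The neighbourhoods in [C] are those of the product of two lines; this passes to the
    modulus, after which limits are real null sequences. *)
Lemma tends_Cmod (u : nat -> C) (l : C) :
  tends u l <-> is_lim_seq (fun n => Cmod (u n - l)) 0.
Proof.
  split; intros H.
  - apply is_lim_seq_spec. intros eps.
    assert (He : (0 < eps / sqrt 2)%R).
    { apply Rdiv_lt_0_compat; [apply eps|apply sqrt_lt_R0; lra]. }
    destruct (proj1 (filterlim_locally u l) H (mkposreal _ He)) as [N HN].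
    exists N. intros n Hn.
    rewrite Rminus_0_r, Rabs_pos_eq by apply Cmod_ge_0.
    assert (Hc := C_NormedModule_mixin_compat2 _ _ _ (HN n Hn)). simpl in Hc.
    replace (sqrt 2 * (eps / sqrt 2))%R with (pos eps) in Hc; [exact Hc|].
    field. apply Rgt_not_eq, sqrt_lt_R0. lra.
  - apply filterlim_locally. intros eps.
    apply is_lim_seq_spec in H. destruct (H eps) as [N HN].
    exists N. intros n Hn. apply C_NormedModule_mixin_compat1.
    specialize (HN n Hn).
    rewrite Rminus_0_r, Rabs_pos_eq in HN by apply Cmod_ge_0. exact HN.
Qed.

Lemma tends_squeeze (u : nat -> C) (l : C) (e : nat -> R) :
  (forall n, Cmod (u n - l) <= e n)%R -> is_lim_seq e 0 -> tends u l.
Proof.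
  intros H He. apply tends_Cmod.
  apply is_lim_seq_le_le with (fun _ => 0%R) e; [|apply is_lim_seq_const|exact He].
  intros n. split; [apply Cmod_ge_0|apply H].
Qed.

Lemma tends_unique (u : nat -> C) (l l' : C) : tends u l -> tends u l' -> l = l'.
Proof. intros H H'. rewrite <- (Clim_correct _ _ H). apply Clim_correct, H'. Qed.

Lemma tends_ext (u v : nat -> C) (l : C) :
  (forall n, u n = v n) -> tends u l -> tends v l.
Proof. intros E. apply filterlim_ext, E. Qed.

Lemma tends_const (c : C) : tends (fun _ => c) c.
Proof. apply filterlim_const. Qed.

Lemma tends_plus (u v : nat -> C) (a b : C) :
  tends u a -> tends v b -> tends (fun n => u n + v n) (a + b).
Proof.
  intros Hu Hv.
  apply (filterlim_comp_2 (F := eventually) (G := locally a) (H := locally b)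
    u v Cplus Hu Hv).
  exact (filterlim_plus (K := C_AbsRing) (V := C_NormedModule) a b).
Qed.

Lemma Cmod_minus_triangle (x y : C) : (Cmod (x - y) <= Cmod x + Cmod y)%R.
Proof. unfold Cminus. rewrite <- (Cmod_opp y). apply Cmod_triangle. Qed.

Lemma tends_bounded (u : nat -> C) (l : C) :
  tends u l -> exists M, (0 < M)%R /\ forall n, (Cmod (u n) <= M)%R.
Proof.
  intros H. apply tends_Cmod in H.
  destruct (filterlim_bounded (fun n => Cmod (u n - l)) (ex_intro _ 0%R H)) as [M HM].
  exists (Rabs M + Cmod l + 1)%R. split.
  { pose proof (Rabs_pos M). pose proof (Cmod_ge_0 l). lra. }
  intros n.
  assert (Ht := Cmod_triangle (u n - l) l).
  replace (u n - l + l) with (u n) in Ht by ring.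
  specialize (HM n). change norm with Rabs in HM.
  rewrite Rabs_pos_eq in HM by apply Cmod_ge_0.
  pose proof (Rle_abs M). lra.
Qed.

Lemma tends_mult (u v : nat -> C) (a b : C) :
  tends u a -> tends v b -> tends (fun n => u n * v n) (a * b).
Proof.
  intros Hu Hv. destruct (tends_bounded _ _ Hu) as [M [M0 HM]].
  apply tends_squeeze with (fun n => M * Cmod (v n - b) + Cmod b * Cmod (u n - a))%R.
  - intros n. replace (u n * v n - a * b) with (u n * (v n - b) + b * (u n - a)) by ring.
    eapply Rle_trans; [apply Cmod_triangle|]. rewrite !Cmod_mult.
    apply Rplus_le_compat_r, Rmult_le_compat_r; [apply Cmod_ge_0|apply HM].
  - apply tends_Cmod in Hu. apply tends_Cmod in Hv.
    replace (Finite 0) with (Finite (M * 0 + Cmod b * 0)) by (f_equal; ring).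
    apply is_lim_seq_plus'.
    + apply (is_lim_seq_scal_l _ M 0 Hv).
    + apply (is_lim_seq_scal_l _ (Cmod b) 0 Hu).
Qed.

Lemma tends_scal (c : C) (u : nat -> C) (a : C) :
  tends u a -> tends (fun n => c * u n) (c * a).
Proof. apply tends_mult, tends_const. Qed.

Lemma tends_minus (u v : nat -> C) (a b : C) :
  tends u a -> tends v b -> tends (fun n => u n - v n) (a - b).
Proof.
  intros Hu Hv. replace (a - b) with (a + (-(1)) * b) by ring.
  apply tends_ext with (fun n => u n + (-(1)) * v n); [intros; ring|].
  apply tends_plus; [|apply tends_scal]; assumption.
Qed.

Lemma tends_pow (u : nat -> C) (a : C) (k : nat) :
  tends u a -> tends (fun n => u n ^ k) (a ^ k).
Proof.
  intros H. induction k as [|k IH]; [apply tends_const|]. simpl. apply tends_mult; assumption.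
Qed.

Lemma tends_inv (u : nat -> C) (a : C) :
  a <> 0 -> (forall n, u n <> 0) -> tends u a -> tends (fun n => / u n) (/ a).
Proof.
  intros Ha Hu H. apply tends_Cmod in H.
  assert (Ha' := proj1 (Cmod_gt_0 a) Ha).
  assert (Hlim : is_lim_seq (fun n => / (Cmod a * Cmod (u n)))%R (/ (Cmod a * Cmod a))%R).
  { apply is_lim_seq_inv with (l := Finite (Cmod a * Cmod a)).
    2:{ intros E. injection E. intros E'. nra. }
    apply (is_lim_seq_scal_l _ (Cmod a) (Cmod a)).
    apply is_lim_seq_le_le with (fun n => Cmod a - Cmod (u n - a))%R (fun n => Cmod a + Cmod (u n - a))%R.
    - intros n. split.
      + assert (Ht := Cmod_minus_triangle (u n) (u n - a)).
        replace (u n - (u n - a)) with a in Ht by ring. lra.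
      + assert (Ht := Cmod_triangle a (u n - a)).
        replace (a + (u n - a)) with (u n) in Ht by ring. lra.
    - replace (Finite (Cmod a)) with (Finite (Cmod a - 0)) by (f_equal; ring).
      apply is_lim_seq_minus'; [apply is_lim_seq_const|exact H].
    - replace (Finite (Cmod a)) with (Finite (Cmod a + 0)) by (f_equal; ring).
      apply is_lim_seq_plus'; [apply is_lim_seq_const|exact H]. }
  apply tends_squeeze with (fun n => Cmod (u n - a) * / (Cmod a * Cmod (u n)))%R.
  - intros n. replace (/ u n - / a) with (- ((u n - a) / (a * u n))) by (field; auto).
    rewrite Cmod_opp, Cmod_div, Cmod_mult by (apply Cmult_neq_0; auto). right. reflexivity.
  - replace (Finite 0) with (Finite (0 * / (Cmod a * Cmod a))) by (f_equal; ring).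
    apply is_lim_seq_mult'; assumption.
Qed.

Lemma tends_div (u v : nat -> C) (a b : C) :
  b <> 0 -> (forall n, v n <> 0) -> tends u a -> tends v b ->
  tends (fun n => u n / v n) (a / b).
Proof. intros. apply tends_mult; [|apply tends_inv]; assumption. Qed.

Lemma tends_subseq (u : nat -> C) (l : C) (s : nat -> nat) (N0 : nat) :
  (forall n, n <= s n + N0)%nat -> tends u l -> tends (fun n => u (s n)) l.
Proof.
  intros Hs H. apply (filterlim_comp _ _ _ s u _ eventually); [|exact H].
  intros P [N HN]. exists (N + N0)%nat. intros n Hn. apply HN. specialize (Hs n). lia.
Qed.

Lemma tends_geom (x : C) : (Cmod x < 1)%R -> tends (fun n => x ^ n) 0.
Proof.
  intros H. apply tends_squeeze with (fun n => (Cmod x) ^ n)%R.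
  - intros n. rewrite <- Cmod_pow. right. f_equal. ring.
  - apply is_lim_seq_geom. rewrite Rabs_pos_eq; [exact H|apply Cmod_ge_0].
Qed.

(** Used as a uniform bound for denominators, as dominated convergence requires. *)
Lemma tends_away (u : nat -> C) (l : C) :
  l <> 0 -> (forall n, u n <> 0) -> tends u l ->
  exists M, (0 < M)%R /\ forall n, (Cmod (/ u n) <= M)%R.
Proof. intros Hl Hu H. exact (tends_bounded _ _ (tends_inv _ _ Hl Hu H)). Qed.

(** * Bilateral sums *)

(** Symmetric partial sums: with the same cut-off for both directions, finite double sums can be
    exchanged on squares, and reflected terms come in pairs. *)
Fixpoint zsum (h : Z -> C) (N : nat) : C :=
  match N with
  | O => h 0%Z
  | S M => zsum h M + (h (Z.of_nat (S M)) + h (- Z.of_nat (S M))%Z)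
  end.

Lemma zsum_S (h : Z -> C) (N : nat) :
  zsum h (S N) = zsum h N + (h (Z.of_nat (S N)) + h (- Z.of_nat (S N))%Z).
Proof. reflexivity. Qed.

Definition is_zsum (h : Z -> C) (l : C) : Prop := tends (zsum h) l.

Lemma zsum_ext (g h : Z -> C) (N : nat) :
  (forall z, g z = h z) -> zsum g N = zsum h N.
Proof. intros E. induction N as [|N IH]; simpl; rewrite ?IH, ?E; reflexivity. Qed.

Lemma zsum_plus (g h : Z -> C) (N : nat) :
  zsum (fun z => g z + h z) N = zsum g N + zsum h N.
Proof. induction N as [|N IH]; simpl; [|rewrite IH]; ring. Qed.

Lemma zsum_scal (c : C) (h : Z -> C) (N : nat) :
  zsum (fun z => c * h z) N = c * zsum h N.
Proof. induction N as [|N IH]; simpl; [|rewrite IH]; ring. Qed.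

Lemma is_zsum_ext (g h : Z -> C) (l : C) :
  (forall z, g z = h z) -> is_zsum g l -> is_zsum h l.
Proof. intros E. apply tends_ext. intros N. apply zsum_ext, E. Qed.

Lemma is_zsum_plus (g h : Z -> C) (a b : C) :
  is_zsum g a -> is_zsum h b -> is_zsum (fun z => g z + h z) (a + b).
Proof.
  intros Hg Hh. apply tends_ext with (fun N => zsum g N + zsum h N).
  - intros N. symmetry. apply zsum_plus.
  - apply tends_plus; assumption.
Qed.

Lemma is_zsum_scal (c : C) (h : Z -> C) (a : C) :
  is_zsum h a -> is_zsum (fun z => c * h z) (c * a).
Proof.
  intros Hh. apply tends_ext with (fun N => c * zsum h N).
  - intros N. symmetry. apply zsum_scal.
  - apply tends_scal, Hh.
Qed.

Lemma is_zsum_minus (g h : Z -> C) (a b : C) :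
  is_zsum g a -> is_zsum h b -> is_zsum (fun z => g z - h z) (a - b).
Proof.
  intros Hg Hh. replace (a - b) with (a + (-(1)) * b) by ring.
  apply is_zsum_ext with (fun z => g z + (-(1)) * h z); [intros; ring|].
  apply is_zsum_plus; [|apply is_zsum_scal]; assumption.
Qed.

Lemma is_zsum_set0 (h : Z -> C) (l c : C) :
  is_zsum h l -> is_zsum (fun z => if Z.eqb z 0 then c else h z) (l - h 0%Z + c).
Proof.
  intros H. apply tends_ext with (fun N => zsum h N - h 0%Z + c).
  - induction n as [|n IH]; [simpl; ring|].
    simpl zsum. rewrite <- IH. simpl. ring.
  - apply tends_plus; [apply tends_minus|]; [exact H|apply tends_const|apply tends_const].
Qed.

Lemma zsum_swap (a : Z -> Z -> C) (K N : nat) :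
  zsum (fun n => zsum (a n) N) K = zsum (fun d => zsum (fun n => a n d) K) N.
Proof.
  induction K as [|K IH]; simpl; [apply zsum_ext; reflexivity|].
  rewrite IH, !zsum_plus. reflexivity.
Qed.

(** Geometric domination in both directions: it bounds tails explicitly and it survives
    shifts. *)
Definition decays (M r : R) (h : Z -> C) : Prop :=
  forall z, (Cmod (h z) <= M * r ^ Z.abs_nat z)%R.

Lemma decays_step (M r : R) (h : Z -> C) (N : nat) :
  decays M r h -> (Cmod (zsum h (S N) - zsum h N) <= 2 * M * r ^ S N)%R.
Proof.
  intros H. rewrite zsum_S.
  replace (zsum h N + (h (Z.of_nat (S N)) + h (- Z.of_nat (S N))%Z) - zsum h N)
    with (h (Z.of_nat (S N)) + h (- Z.of_nat (S N))%Z) by ring.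
  eapply Rle_trans; [apply Cmod_triangle|].
  assert (H1 := H (Z.of_nat (S N))). assert (H2 := H (- Z.of_nat (S N))%Z).
  rewrite Zabs2Nat.id in H1.
  replace (Z.abs_nat (- Z.of_nat (S N))) with (S N) in H2 by lia. lra.
Qed.

Lemma decays_tail (M r : R) (h : Z -> C) (K n : nat) :
  (0 <= r < 1)%R -> decays M r h ->
  (Cmod (zsum h (K + n) - zsum h K) <= 2 * M / (1 - r) * (r ^ S K - r ^ S (K + n)))%R.
Proof.
  intros Hr H. induction n as [|n IH].
  - rewrite Nat.add_0_r. replace (zsum h K - zsum h K) with (RtoC 0) by ring.
    rewrite Cmod_0. right. field. lra.
  - rewrite Nat.add_succ_r.
    replace (zsum h (S (K + n)) - zsum h K)
      with ((zsum h (S (K + n)) - zsum h (K + n)) + (zsum h (K + n) - zsum h K)) by ring.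
    eapply Rle_trans; [apply Cmod_triangle|].
    eapply Rle_trans; [apply Rplus_le_compat; [apply decays_step, H|apply IH]|].
    right. simpl. field. lra.
Qed.

Lemma decays_nonneg (M r : R) (h : Z -> C) : decays M r h -> (0 <= M)%R.
Proof.
  intros H. specialize (H 0%Z). simpl in H. pose proof (Cmod_ge_0 (h 0%Z)). lra.
Qed.

Lemma decays_tail_pow (M r : R) (h : Z -> C) (K N : nat) :
  (0 <= r < 1)%R -> decays M r h -> (K <= N)%nat ->
  (Cmod (zsum h N - zsum h K) <= 2 * M / (1 - r) * r ^ K)%R.
Proof.
  intros Hr H HKN. assert (HM := decays_nonneg _ _ _ H).
  replace N with (K + (N - K))%nat by lia.
  eapply Rle_trans; [apply decays_tail; eassumption|].
  apply Rmult_le_compat_l.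
  - apply Rmult_le_pos; [lra|]. left. apply Rinv_0_lt_compat. lra.
  - assert (0 <= r ^ K)%R by (apply pow_le; lra).
    assert (0 <= r ^ S (K + (N - K)))%R by (apply pow_le; lra).
    simpl pow at 1. nra.
Qed.

Lemma decays_zsum_bound (M r : R) (h : Z -> C) (N : nat) :
  (0 <= r < 1)%R -> decays M r h -> (Cmod (zsum h N) <= M * (1 + 2 / (1 - r)))%R.
Proof.
  intros Hr H. assert (Ht := decays_tail_pow _ _ _ 0 N Hr H (Nat.le_0_l N)).
  assert (H0 := H 0%Z). simpl in Ht, H0.
  assert (Htr := Cmod_triangle (zsum h N - h 0%Z) (h 0%Z)).
  replace (zsum h N - h 0%Z + h 0%Z) with (zsum h N) in Htr by ring.
  unfold Rdiv in *. lra.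
Qed.

Lemma decays_cvg (M r : R) (h : Z -> C) :
  (0 <= r < 1)%R -> decays M r h -> exists l, is_zsum h l.
Proof.
  intros Hr H.
  assert (Hex : ex_series (fun n => zsum h (S n) - zsum h n)).
  { apply (ex_series_le (K := C_AbsRing) (V := C_CompleteNormedModule) _
      (fun n => 2 * M * r * r ^ n)%R).
    - intros n. change norm with Cmod. eapply Rle_trans; [apply decays_step, H|].
      right. simpl. ring.
    - apply (ex_series_scal_l (2 * M * r)%R (fun n => r ^ n)%R).
      apply ex_series_geom. rewrite Rabs_pos_eq; lra. }
  destruct Hex as [s Hs]. exists (h 0%Z + s).
  assert (E : forall n, zsum h (S n) = h 0%Z + sum_n (fun n => zsum h (S n) - zsum h n) n).
  { induction n as [|n IH].
    - rewrite sum_O. change (zsum h 0) with (h 0%Z). ring.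
    - rewrite sum_Sn. change plus with Cplus. rewrite Cplus_assoc, <- IH. ring. }
  apply (tends_subseq (fun n => match n with O => 0 | S m => zsum h m end) _ S 0); [intros; lia|].
  apply (filterlim_ext_loc (fun n => h 0%Z + sum_n (fun n => zsum h (S n) - zsum h n) (n - 2))).
  - exists 2%nat. intros [|[|n]] Hn; try lia. simpl (_ - _)%nat. rewrite Nat.sub_0_r. symmetry. apply E.
  - apply tends_plus; [apply tends_const|].
    apply (tends_subseq _ _ (fun n => n - 2)%nat 2); [intros; lia|exact Hs].
Qed.

Lemma tends_Cmod_le (u : nat -> C) (l : C) (B : R) :
  tends u l -> (forall n, Cmod (u n) <= B)%R -> (Cmod l <= B)%R.
Proof.
  intros H HB. apply tends_Cmod in H.
  assert (Hl : Rbar_le (Cmod l) (B + 0)%R).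
  { apply is_lim_seq_le with (fun _ => Cmod l) (fun n => B + Cmod (u n - l))%R.
    - intros n. assert (Ht := Cmod_minus_triangle (u n) (u n - l)).
      replace (u n - (u n - l)) with l in Ht by ring. specialize (HB n). lra.
    - apply is_lim_seq_const.
    - apply is_lim_seq_plus'; [apply is_lim_seq_const|exact H]. }
  simpl in Hl. lra.
Qed.

Lemma tends_zsum (f : nat -> Z -> C) (g : Z -> C) (K : nat) :
  (forall z, tends (fun N => f N z) (g z)) -> tends (fun N => zsum (f N) K) (zsum g K).
Proof. intros H. induction K as [|K IH]; simpl; auto using tends_plus. Qed.

(** Dominated convergence where the range of summation grows together with the parameter: this
    is what the passage from finite partial fractions to a bilateral series requires. *)
Lemma tannery (M r : R) (f : nat -> Z -> C) (g : Z -> C) :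
  (0 <= r < 1)%R -> (forall N, decays M r (f N)) ->
  (forall z, tends (fun N => f N z) (g z)) ->
  exists l, is_zsum g l /\ tends (fun N => zsum (f N) N) l.
Proof.
  intros Hr Hf Hg.
  assert (Hgd : decays M r g).
  { intros z. apply (tends_Cmod_le _ _ _ (Hg z)). intros N. apply Hf. }
  destruct (decays_cvg _ _ _ Hr Hgd) as [l Hl]. exists l. split; [exact Hl|].
  assert (HM := decays_nonneg _ _ _ Hgd).
  set (B := (2 * M / (1 - r))%R).
  assert (HB : (0 <= B)%R).
  { apply Rmult_le_pos; [lra|]. left. apply Rinv_0_lt_compat. lra. }
  (* Cut both sums at a fixed [K]: the tails are small uniformly in [N], and the finite parts
     converge. *)
  assert (Hd : tends (fun N => zsum (f N) N - zsum g N) 0).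
  { apply tends_Cmod, is_lim_seq_spec. intros eps.
    assert (Hgeo : is_lim_seq (fun K => 2 * B * r ^ K)%R 0).
    { replace (Finite 0) with (Finite (2 * B * 0)) by (f_equal; ring).
      apply (is_lim_seq_scal_l _ (2 * B) 0). apply is_lim_seq_geom.
      rewrite Rabs_pos_eq; lra. }
    apply is_lim_seq_spec in Hgeo.
    assert (He : (0 < eps / 2)%R) by (pose proof (cond_pos eps); lra).
    destruct (Hgeo (mkposreal _ He)) as [K HK]. specialize (HK K (Nat.le_refl K)).
    simpl in HK. rewrite Rminus_0_r in HK.
    assert (HK' := Rle_abs (2 * B * r ^ K)).
    assert (Hfin := tends_minus _ _ _ _ (tends_zsum f g K Hg) (tends_const (zsum g K))).
    apply tends_Cmod, is_lim_seq_spec in Hfin.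
    destruct (Hfin (mkposreal _ He)) as [N0 HN0]. simpl in HN0.
    exists (max K N0). intros N HN. specialize (HN0 N ltac:(lia)).
    rewrite Rminus_0_r, Rabs_pos_eq in * by apply Cmod_ge_0.
    replace (zsum (f N) K - zsum g K - (zsum g K - zsum g K))
      with (zsum (f N) K - zsum g K) in HN0 by ring.
    replace (zsum (f N) N - zsum g N - 0)
      with ((zsum (f N) K - zsum g K) + ((zsum (f N) N - zsum (f N) K) - (zsum g N - zsum g K)))
      by ring.
    eapply Rle_lt_trans; [apply Cmod_triangle|].
    assert (H1 := Cmod_minus_triangle (zsum (f N) N - zsum (f N) K) (zsum g N - zsum g K)).
    assert (H2 := decays_tail_pow _ _ _ K N Hr (Hf N) ltac:(lia)).
    assert (H3 := decays_tail_pow _ _ _ K N Hr Hgd ltac:(lia)).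
    fold B in H2, H3. lra. }
  apply tends_ext with (fun N => (zsum (f N) N - zsum g N) + zsum g N); [intros; ring|].
  replace l with (0 + l) by ring. apply tends_plus; assumption.
Qed.

(** The sums over the squares [|n|, |d| <= N] tend to each of the two iterated sums, by
    dominated convergence for the inner partial sums. *)
Lemma fubini (M r : R) (a : Z -> Z -> C) (R1 R2 : Z -> C) :
  (0 <= r < 1)%R ->
  (forall n d, Cmod (a n d) <= M * r ^ Z.abs_nat n * r ^ Z.abs_nat d)%R ->
  (forall n, is_zsum (a n) (R1 n)) -> (forall d, is_zsum (fun n => a n d) (R2 d)) ->
  exists l, is_zsum R1 l /\ is_zsum R2 l.
Proof.
  intros Hr Ha H1 H2.
  set (B := (M * (1 + 2 / (1 - r)))%R).
  destruct (tannery B r (fun N n => zsum (a n) N) R1 Hr) as [l1 [Hl1 Hs1]].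
  { intros N n. eapply Rle_trans.
    - apply decays_zsum_bound with (M := (M * r ^ Z.abs_nat n)%R) (r := r); [exact Hr|].
      intros d. apply Ha.
    - right. unfold B. ring. }
  { exact H1. }
  destruct (tannery B r (fun N d => zsum (fun n => a n d) N) R2 Hr) as [l2 [Hl2 Hs2]].
  { intros N d. eapply Rle_trans.
    - apply decays_zsum_bound with (M := (M * r ^ Z.abs_nat d)%R) (r := r); [exact Hr|].
      intros n. eapply Rle_trans; [apply Ha|]. right. ring.
    - right. unfold B. ring. }
  { exact H2. }
  exists l1. split; [exact Hl1|].
  replace l1 with l2; [exact Hl2|].
  apply (tends_unique _ _ _ Hs2). apply (tends_ext _ _ _ (fun N => zsum_swap a N N)), Hs1.
Qed.

Lemma is_zsum_telescope1 (a : Z -> C) (Lp Lm : C) :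
  tends (fun n => a (Z.of_nat n + 1)%Z) Lp -> tends (fun n => a (- Z.of_nat n)%Z) Lm ->
  is_zsum (fun z => a z - a (z + 1)%Z) (Lm - Lp).
Proof.
  intros Hp Hm. apply tends_ext with (fun N => a (- Z.of_nat N)%Z - a (Z.of_nat N + 1)%Z).
  - induction n as [|n IH]; [reflexivity|].
    rewrite zsum_S, <- IH.
    replace (- Z.of_nat (S n) + 1)%Z with (- Z.of_nat n)%Z by lia.
    replace (Z.of_nat (S n)) with (Z.of_nat n + 1)%Z by lia. ring.
  - apply tends_minus; assumption.
Qed.

(** A shift by [d] is made of [d] unit shifts, each of which contributes the jump of [a] between
    its two ends. *)
Lemma is_zsum_telescope (a : Z -> C) (Lp Lm : C) (d : Z) :
  (forall e, tends (fun n => a (Z.of_nat n + e)%Z) Lp) ->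
  (forall e, tends (fun n => a (- Z.of_nat n + e)%Z) Lm) ->
  is_zsum (fun z => a z - a (z + d)%Z) (IZR d * (Lm - Lp)).
Proof.
  intros Hp Hm.
  assert (Hstep : forall e, is_zsum (fun z => a (z + e)%Z - a (z + e + 1)%Z) (Lm - Lp)).
  { intros e. apply is_zsum_ext with (fun z => a (z + e)%Z - a (z + 1 + e)%Z).
    - intros z. do 2 f_equal. lia.
    - apply (is_zsum_telescope1 (fun z => a (z + e)%Z)).
      + apply tends_ext with (fun n => a (Z.of_nat n + (1 + e))%Z); [intros; f_equal; lia|apply Hp].
      + apply Hm. }
  induction d as [|d IH|d IH] using Z.peano_ind.
  - apply is_zsum_ext with (fun _ => 0 * 0).
    + intros z. rewrite Z.add_0_r. ring.
    + replace (IZR 0 * (Lm - Lp)) with (0 * 0) by ring.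
      apply (is_zsum_scal 0 (fun _ => 0) 0).
      apply tends_ext with (fun _ => 0); [|apply tends_const].
      intros N. induction N as [|N IHN]; simpl; [|rewrite <- IHN]; ring.
  - apply is_zsum_ext with (fun z => (a z - a (z + d)%Z) + (a (z + d)%Z - a (z + d + 1)%Z)).
    + intros z. replace (z + d + 1)%Z with (z + Z.succ d)%Z by lia. ring.
    + replace (IZR (Z.succ d) * (Lm - Lp)) with (IZR d * (Lm - Lp) + (Lm - Lp)).
      * apply is_zsum_plus; [exact IH|apply Hstep].
      * rewrite succ_IZR, RtoC_plus. ring.
  - apply is_zsum_ext with (fun z => (a z - a (z + d)%Z) - (a (z + Z.pred d)%Z - a (z + Z.pred d + 1)%Z)).
    + intros z. replace (z + Z.pred d + 1)%Z with (z + d)%Z by lia. ring.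
    + replace (IZR (Z.pred d) * (Lm - Lp)) with (IZR d * (Lm - Lp) - (Lm - Lp)).
      * apply is_zsum_minus; [exact IH|apply Hstep].
      * rewrite <- (Z.succ_pred d) at 1. rewrite succ_IZR, RtoC_plus. ring.
Qed.

(** The telescoping sum with both limits zero. *)
Lemma is_zsum_shift (M r : R) (h : Z -> C) (l : C) (d : Z) :
  (0 <= r < 1)%R -> decays M r h -> is_zsum h l -> is_zsum (fun z => h (z + d)%Z) l.
Proof.
  intros Hr Hd H.
  assert (Hlim : forall s : nat -> Z, (exists N0, forall n, n <= Z.abs_nat (s n) + N0)%nat ->
    tends (fun n => h (s n)) 0).
  { intros s [N0 Hs].
    assert (Hg := tends_scal M _ _ (tends_subseq _ _ (fun n => Z.abs_nat (s n)) N0 Hs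
      (tends_geom r ltac:(rewrite Cmod_R, Rabs_pos_eq; lra)))).
    apply tends_Cmod in Hg. apply tends_squeeze with (2 := Hg).
    intros n. simpl. replace (h (s n) - 0) with (h (s n)) by ring.
    eapply Rle_trans; [apply Hd|].
    replace (M * r ^ Z.abs_nat (s n) - M * 0) with (RtoC (M * r ^ Z.abs_nat (s n)))
      by (rewrite RtoC_mult, RtoC_pow; ring).
    rewrite Cmod_R. apply Rle_abs. }
  assert (Ht := is_zsum_telescope h 0 0 d).
  replace l with (l - IZR d * (0 - 0)) by ring.
  apply is_zsum_ext with (fun z => h z - (h z - h (z + d)%Z)); [intros; ring|].
  apply is_zsum_minus; [exact H|apply Ht]; intros e; apply Hlim; exists (Z.abs_nat e); intros n; lia.
Qed.

(** * Integer powers *)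

Lemma Cinv_neq_0 (x : C) : x <> 0 -> / x <> 0.
Proof. intros H E. apply C1_nz. rewrite <- (Cinv_l x H), E. ring. Qed.

Lemma Cinv_inv (x : C) : x <> 0 -> / / x = x.
Proof.
  intros H. replace (/ / x) with (/ / x * (/ x * x)) by (rewrite (Cinv_l x H); ring).
  rewrite Cmult_assoc, Cinv_l by (apply Cinv_neq_0, H). ring.
Qed.

Lemma Cmult_cancel_r (c x y : C) : c <> 0 -> x * c = y * c -> x = y.
Proof.
  intros Hc E. replace x with (x * c / c) by (field; exact Hc). rewrite E. field. exact Hc.
Qed.

Lemma Cdiv_neq_0 (x y : C) : x <> 0 -> y <> 0 -> x / y <> 0.
Proof. intros Hx Hy. apply Cmult_neq_0; [exact Hx|apply Cinv_neq_0, Hy]. Qed.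

(** The translates of a point by the lattice are its products by all integer powers of [q]. *)
Definition zpow (q : C) (z : Z) : C :=
  match z with
  | Z0 => 1
  | Zpos n => q ^ Pos.to_nat n
  | Zneg n => / q ^ Pos.to_nat n
  end.

Lemma zpow_nat (q : C) (n : nat) : zpow q (Z.of_nat n) = q ^ n.
Proof.
  destruct n as [|n]; [reflexivity|]. change (q ^ Pos.to_nat (Pos.of_succ_nat n) = q ^ S n).
  rewrite SuccNat2Pos.id_succ. reflexivity.
Qed.

Lemma zpow_opp_nat (q : C) (n : nat) : zpow q (- Z.of_nat n) = / q ^ n.
Proof.
  destruct n as [|n]; [simpl; field|]. change (/ q ^ Pos.to_nat (Pos.of_succ_nat n) = / q ^ S n).
  rewrite SuccNat2Pos.id_succ. reflexivity.
Qed.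

Lemma Z_nat_cases (P : Z -> Prop) :
  (forall n, P (Z.of_nat n)) -> (forall n, P (- Z.of_nat n)%Z) -> forall z, P z.
Proof.
  intros H1 H2 z. destruct (Z_le_gt_dec 0 z).
  - replace z with (Z.of_nat (Z.to_nat z)) by lia. apply H1.
  - replace z with (- Z.of_nat (Z.to_nat (- z)))%Z by lia. apply H2.
Qed.

Lemma zpow_succ (q : C) (z : Z) : q <> 0 -> zpow q (z + 1) = zpow q z * q.
Proof.
  intros Hq. revert z. apply Z_nat_cases; intros n.
  - replace (Z.of_nat n + 1)%Z with (Z.of_nat (S n)) by lia. rewrite !zpow_nat. simpl. ring.
  - destruct n as [|n]; [simpl; ring|].
    replace (- Z.of_nat (S n) + 1)%Z with (- Z.of_nat n)%Z by lia.
    rewrite !zpow_opp_nat. simpl. field. split; [apply Cpow_nz|]; exact Hq.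
Qed.

Lemma zpow_nz (q : C) (z : Z) : q <> 0 -> zpow q z <> 0.
Proof.
  intros Hq. revert z. apply Z_nat_cases; intros n.
  - rewrite zpow_nat. apply Cpow_nz, Hq.
  - rewrite zpow_opp_nat. apply Cinv_neq_0, Cpow_nz, Hq.
Qed.

Lemma zpow_add (q : C) (y z : Z) : q <> 0 -> zpow q (y + z) = zpow q y * zpow q z.
Proof.
  intros Hq. induction z as [|z IH|z IH] using Z.peano_ind.
  - rewrite Z.add_0_r. simpl. ring.
  - replace (y + Z.succ z)%Z with (y + z + 1)%Z by lia.
    unfold Z.succ. rewrite !zpow_succ, IH by exact Hq. ring.
  - apply (Cmult_cancel_r q); [exact Hq|].
    rewrite <- Cmult_assoc, <- !zpow_succ by exact Hq.
    replace (y + Z.pred z + 1)%Z with (y + z)%Z by lia.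
    replace (Z.pred z + 1)%Z with z by lia. exact IH.
Qed.

Lemma zpow_mult_l (a b : C) (z : Z) : a <> 0 -> b <> 0 -> zpow (a * b) z = zpow a z * zpow b z.
Proof.
  intros Ha Hb. revert z. apply Z_nat_cases; intros n.
  - rewrite !zpow_nat. apply Cpow_mult_l.
  - rewrite !zpow_opp_nat, Cpow_mult_l. field. split; apply Cpow_nz; assumption.
Qed.

Lemma Cmod_pow_le1 (q : C) (n : nat) : (Cmod q < 1)%R -> (Cmod (q ^ n) <= 1)%R.
Proof.
  intros Hq. rewrite Cmod_pow, <- (pow1 n). apply pow_incr.
  split; [apply Cmod_ge_0|lra].
Qed.

Lemma Cpow_neq_1 (q : C) (n : nat) : (Cmod q < 1)%R -> (0 < n)%nat -> q ^ n <> 1.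
Proof.
  intros Hq Hn E. apply (f_equal Cmod) in E. rewrite Cmod_1 in E.
  destruct n as [|n]; [lia|]. simpl in E. rewrite Cmod_mult in E.
  assert (H := Cmod_pow_le1 q n Hq). pose proof (Cmod_ge_0 q).
  pose proof (Cmod_ge_0 (q ^ n)). nra.
Qed.

Lemma zpow_neq_1 (q : C) (z : Z) : q <> 0 -> (Cmod q < 1)%R -> z <> 0%Z -> zpow q z <> 1.
Proof.
  intros Hq0 Hq. revert z. apply (Z_nat_cases (fun z => z <> 0%Z -> zpow q z <> 1)); intros n Hn.
  - rewrite zpow_nat. apply Cpow_neq_1; [exact Hq|lia].
  - rewrite zpow_opp_nat. intros E. apply (Cpow_neq_1 q n Hq ltac:(lia)).
    rewrite <- (Cinv_inv (q ^ n)), E; [field|].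
    intros E0. rewrite E0 in E. apply (Cpow_nz q n Hq0 E0).
Qed.

(** * Infinite products *)

Lemma qpoch_S (a q : C) (n : nat) : qpoch a q (S n) = qpoch a q n * (1 - a * q ^ n).
Proof. reflexivity. Qed.

Lemma qpoch_shift (a q : C) (n : nat) : qpoch a q (S n) = (1 - a) * qpoch (a * q) q n.
Proof.
  induction n as [|n IH]; [simpl; ring|].
  change (qpoch a q (S (S n))) with (qpoch a q (S n) * (1 - a * q ^ S n)).
  rewrite IH. simpl. ring.
Qed.

Lemma qpoch_plus (a q : C) (m n : nat) :
  qpoch a q (m + n) = qpoch a q m * qpoch (a * q ^ m) q n.
Proof.
  induction n as [|n IH]; [rewrite Nat.add_0_r; simpl; ring|].
  rewrite Nat.add_succ_r. simpl. rewrite IH, Cpow_add_r. ring.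
Qed.

Lemma qpoch_nz (a q : C) (n : nat) :
  (forall k, (k < n)%nat -> a * q ^ k <> 1) -> qpoch a q n <> 0.
Proof.
  induction n as [|n IH]; intros H; simpl; [exact C1_nz|].
  apply Cmult_neq_0; [apply IH; intros k Hk; apply H; lia|].
  intros E. apply (H n); [lia|].
  replace (a * q ^ n) with (1 - (1 - a * q ^ n)) by ring. rewrite E. ring.
Qed.

Lemma qpoch_tends (a q : C) : (Cmod q < 1)%R -> tends (qpoch a q) (qpoch_inf a q).
Proof. apply qpoch_cvg. Qed.

Lemma geom_sum_le (r : R) (n : nat) :
  (0 <= r < 1)%R -> ((1 - r) * sum_f_R0 (fun k => r ^ k)%R n <= 1)%R.
Proof.
  intros Hr. rewrite tech3 by lra.
  assert (0 <= r ^ S n)%R by (apply pow_le; lra).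
  replace ((1 - r) * ((1 - r ^ S n) / (1 - r)))%R with (1 - r ^ S n)%R by (field; lra). lra.
Qed.

(** The modulus of a product of factors [1 - t_k] is at least one minus the sum of the [|t_k|],
    as long as that sum does not exceed one. *)
Lemma qpoch_small_lower (b q : C) (n : nat) :
  (Cmod q < 1)%R -> (Cmod b <= (1 - Cmod q) / 2)%R -> (/ 2 <= Cmod (qpoch b q n))%R.
Proof.
  intros Hq Hb. assert (H0 := Cmod_ge_0 q). assert (Hb0 := Cmod_ge_0 b).
  assert (Hs : forall k, (Cmod b * sum_f_R0 (fun k => Cmod q ^ k)%R k <= / 2)%R).
  { intros k. assert (H := geom_sum_le (Cmod q) k ltac:(lra)).
    assert (0 <= sum_f_R0 (fun k => Cmod q ^ k)%R k)%R.
    { apply cond_pos_sum. intros i. apply pow_le; lra. }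
    nra. }
  destruct n as [|n]; [simpl; rewrite Cmod_1; lra|].
  apply Rle_trans with (1 - Cmod b * sum_f_R0 (fun k => Cmod q ^ k)%R n)%R;
    [specialize (Hs n); lra|].
  assert (Hstep : forall k, (1 - Cmod b * Cmod q ^ k <= Cmod (1 - b * q ^ k))%R).
  { intros k. assert (Ht := Cmod_triangle (1 - b * q ^ k) (b * q ^ k)).
    replace (1 - b * q ^ k + b * q ^ k) with (RtoC 1) in Ht by ring.
    rewrite Cmod_1, Cmod_mult, Cmod_pow in Ht. lra. }
  induction n as [|n IH].
  - change (qpoch b q 1) with (1 * (1 - b * q ^ 0)). rewrite Cmult_1_l. apply Hstep.
  - change (qpoch b q (S (S n))) with (qpoch b q (S n) * (1 - b * q ^ S n)).
    rewrite Cmod_mult, tech5, Rmult_plus_distr_l.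
    assert (H1 := Hs n). assert (H2 := Hstep (S n)). assert (H3 := Hs (S n)).
    rewrite tech5, Rmult_plus_distr_l in H3.
    assert (Hp : (0 <= Cmod b * Cmod q ^ S n)%R)
      by (apply Rmult_le_pos; [exact Hb0|apply pow_le; lra]).
    set (x := (Cmod b * Cmod q ^ S n)%R) in *.
    set (s := (Cmod b * sum_f_R0 (fun k => Cmod q ^ k)%R n)%R) in *.
    assert (Hs0 : (0 <= s)%R).
    { apply Rmult_le_pos; [exact Hb0|]. apply cond_pos_sum. intros i. apply pow_le; lra. }
    apply Rle_trans with ((1 - s) * (1 - x))%R.
    + nra.
    + apply Rmult_le_compat; lra.
Qed.

(** The first factors are nonzero and finite in number; the others form a product which stays
    above one half. *)
Lemma qpoch_inf_nz (a q : C) :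
  (Cmod q < 1)%R -> (forall k, a * q ^ k <> 1) -> qpoch_inf a q <> 0.
Proof.
  intros Hq Ha. assert (H0 := Cmod_ge_0 q). assert (Ha0 := Cmod_ge_0 a).
  assert (Hgeo : is_lim_seq (fun K => Cmod a * Cmod q ^ K)%R 0).
  { replace (Finite 0) with (Finite (Cmod a * 0)) by (f_equal; ring).
    apply (is_lim_seq_scal_l _ (Cmod a) 0). apply is_lim_seq_geom.
    rewrite Rabs_pos_eq; lra. }
  apply is_lim_seq_spec in Hgeo.
  assert (He : (0 < (1 - Cmod q) / 2)%R) by lra.
  destruct (Hgeo (mkposreal _ He)) as [K HK]. specialize (HK K (Nat.le_refl K)).
  simpl in HK. rewrite Rminus_0_r in HK.
  assert (HK' := Rle_abs (Cmod a * Cmod q ^ K)).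
  assert (Hnz := qpoch_nz a q K (fun k _ => Ha k)).
  assert (Hpos := proj1 (Cmod_gt_0 _) Hnz).
  assert (Hlow : forall n, (Cmod (qpoch a q K) * / 2 <= Cmod (qpoch a q (K + n)))%R).
  { intros n. rewrite qpoch_plus, Cmod_mult. apply Rmult_le_compat_l; [lra|].
    apply qpoch_small_lower; [exact Hq|]. rewrite Cmod_mult, Cmod_pow. lra. }
  intros E.
  assert (Hlim := tends_subseq _ _ (fun n => K + n)%nat 0 ltac:(intros; cbv beta; lia) (qpoch_tends a q Hq)).
  rewrite E in Hlim. apply tends_Cmod, is_lim_seq_spec in Hlim.
  assert (He' : (0 < Cmod (qpoch a q K) * / 2)%R) by lra.
  destruct (Hlim (mkposreal _ He')) as [N HN]. specialize (HN N (Nat.le_refl N)). simpl in HN.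
  rewrite Rminus_0_r, Rabs_pos_eq in HN by apply Cmod_ge_0.
  replace (qpoch a q (K + N) - 0) with (qpoch a q (K + N)) in HN by ring.
  specialize (Hlow N). lra.
Qed.

Lemma qpoch_inf_step (a q : C) :
  (Cmod q < 1)%R -> qpoch_inf a q = (1 - a) * qpoch_inf (a * q) q.
Proof.
  intros Hq. apply (tends_unique (fun n => qpoch a q (S n))).
  - apply (tends_subseq _ _ S 0); [intros; lia|apply qpoch_tends, Hq].
  - apply tends_ext with (fun n => (1 - a) * qpoch (a * q) q n).
    + intros n. symmetry. apply qpoch_shift.
    + apply tends_scal, qpoch_tends, Hq.
Qed.

Lemma Cmod_pow_lt_1 (q : C) (k : nat) : (Cmod q < 1)%R -> (Cmod (q ^ S k) < 1)%R.
Proof.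
  intros Hq. simpl. rewrite Cmod_mult.
  assert (H := Cmod_pow_le1 q k Hq). pose proof (Cmod_ge_0 q).
  pose proof (Cmod_ge_0 (q ^ k)). nra.
Qed.

Lemma qpoch_inf_mod3 (a q : C) : (Cmod q < 1)%R ->
  qpoch_inf a q = qpoch_inf a (q ^ 3) * qpoch_inf (a * q) (q ^ 3) * qpoch_inf (a * q ^ 2) (q ^ 3).
Proof.
  intros Hq. assert (Hq3 := Cmod_pow_lt_1 q 2 Hq).
  apply (tends_unique (fun n => qpoch a q (3 * n))).
  - apply (tends_subseq _ _ (fun n => 3 * n)%nat 0); [intros; lia|apply qpoch_tends, Hq].
  - apply tends_ext with
      (fun n => qpoch a (q ^ 3) n * qpoch (a * q) (q ^ 3) n * qpoch (a * q ^ 2) (q ^ 3) n).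
    + induction n as [|n IH]; [simpl; ring|].
      replace (3 * S n)%nat with (S (S (S (3 * n)))) by lia.
      transitivity (qpoch a q (3 * n) * (1 - a * q ^ (3 * n)) * (1 - a * q ^ S (3 * n))
        * (1 - a * q ^ S (S (3 * n)))); [|reflexivity].
      rewrite <- IH, !qpoch_S, <- Cpow_mult_r.
      generalize (qpoch a (q ^ 3) n) (qpoch (a * q) (q ^ 3) n) (qpoch (a * q ^ 2) (q ^ 3) n).
      intros. rewrite !Cpow_S. ring.
    + apply tends_mult; [apply tends_mult|]; apply qpoch_tends, Hq3.
Qed.

Lemma qpoch_inf_square (a q : C) : (Cmod q < 1)%R ->
  qpoch_inf a q * qpoch_inf (- a) q = qpoch_inf (a ^ 2) (q ^ 2).
Proof.
  intros Hq. assert (Hq2 := Cmod_pow_lt_1 q 1 Hq).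
  apply (tends_unique (fun n => qpoch a q n * qpoch (- a) q n)).
  - apply tends_mult; apply qpoch_tends, Hq.
  - apply tends_ext with (qpoch (a ^ 2) (q ^ 2)); [|apply qpoch_tends, Hq2].
    induction n as [|n IH]; [simpl; ring|].
    rewrite !qpoch_S, IH, <- Cpow_mult_r, Nat.mul_comm, Cpow_mult_r. ring.
Qed.

(** The factors over the three cube roots of unity multiply to [1 - a^3 q^(3n)]. *)
Lemma qpoch_inf_cube (a q w : C) : (Cmod q < 1)%R -> w ^ 2 + w + 1 = 0 ->
  qpoch_inf a q * qpoch_inf (a * w) q * qpoch_inf (a * w ^ 2) q = qpoch_inf (a ^ 3) (q ^ 3).
Proof.
  intros Hq Hw. assert (Hq3 := Cmod_pow_lt_1 q 2 Hq).
  assert (Hfac : forall x, (1 - x) * (1 - x * w) * (1 - x * w ^ 2) = 1 - x ^ 3).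
  { intros x. replace (w ^ 2) with (- w - 1); [|rewrite <- (Cplus_0_r (- w - 1)), <- Hw; ring].
    transitivity (1 - x ^ 3 + (x ^ 3 - x ^ 2) * (w ^ 2 + w + 1)); [ring|rewrite Hw; ring]. }
  apply (tends_unique (fun n => qpoch a q n * qpoch (a * w) q n * qpoch (a * w ^ 2) q n)).
  - apply tends_mult; [apply tends_mult|]; apply qpoch_tends, Hq.
  - apply tends_ext with (qpoch (a ^ 3) (q ^ 3)); [|apply qpoch_tends, Hq3].
    induction n as [|n IH]; [simpl; ring|].
    rewrite !qpoch_S, <- Cpow_mult_r, Nat.mul_comm, Cpow_mult_r, IH.
    transitivity (qpoch a q n * qpoch (a * w) q n * qpoch (a * w ^ 2) q n
      * ((1 - a * q ^ n) * (1 - a * q ^ n * w) * (1 - a * q ^ n * w ^ 2))); [|ring].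
    rewrite Hfac. ring.
Qed.

(** * The bilateral sum of Kronecker *)

(** The factor [G] is [(-1)^n q^(n(n+1)/2)]; it is free of [w], so that it cancels in the quotient
    of two such products. *)
Lemma qpoch_reflect (q : C) (n : nat) : q <> 0 ->
  exists G : C, G <> 0 /\
    forall w : C, w <> 0 -> qpoch (w / q ^ n) q n * G = w ^ n * qpoch (q / w) q n.
Proof.
  intros Hq. induction n as [|n [G [HG IH]]].
  - exists 1. split; [exact C1_nz|]. intros w _. simpl. ring.
  - exists (- q ^ S n * G). split.
    { apply Cmult_neq_0; [|exact HG]. intros E. apply (Cpow_nz q (S n) Hq).
      replace (q ^ S n) with (- - q ^ S n) by ring. rewrite E. ring. }
    intros w Hw. rewrite qpoch_shift, qpoch_S.
    replace (w / q ^ S n * q) with (w / q ^ n)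
      by (simpl; field; split; [apply Cpow_nz|]; exact Hq).
    transitivity (- q ^ S n * (1 - w / q ^ S n) * (qpoch (w / q ^ n) q n * G)); [ring|].
    rewrite IH by exact Hw. simpl. field.
    split; [exact Hw|split; [apply Cpow_nz|]; exact Hq].
Qed.

(** The coefficient of the pole [y = q^(-k)] of [(xy;q)_n / (y;q)_(n+1)], arranged so that it is
    visibly bounded by a multiple of [|x|^k]. *)
Definition pfcoef (x q : C) (n k : nat) : C :=
  x ^ k * qpoch (q / x) q k * qpoch x q (n - k) / (qpoch q q k * qpoch q q (n - k)).

Lemma qpoch_qq_nz (q : C) (n : nat) : (Cmod q < 1)%R -> qpoch q q n <> 0.
Proof.
  intros Hq. apply qpoch_nz. intros k _. rewrite <- Cpow_S. apply Cpow_neq_1; [exact Hq|lia].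
Qed.

Lemma Csub_nz_sym (a b : C) : a - b <> 0 -> b - a <> 0.
Proof. intros H E. apply H. replace (a - b) with (- (b - a)) by ring. rewrite E. ring. Qed.

Lemma one_minus_nz (a : C) : a <> 1 -> 1 - a <> 0.
Proof. intros H E. apply H. replace a with (1 - (1 - a)) by ring. rewrite E. ring. Qed.

(* Equalities between terms of a finite sum are typed in the abstract structure carried
   by [C]; the ring tactics need them in [C] itself. *)
Ltac C_eq := match goal with |- @eq _ ?a ?b => change (@eq C a b) end.

Lemma Csum_n_scal (c : C) (u : nat -> C) (n : nat) :
  (sum_n (fun k => c * u k) n : C) = c * sum_n u n.
Proof.
  induction n as [|n IH]; [rewrite !sum_O; reflexivity|].
  rewrite !sum_Sn, IH. change plus with Cplus. ring.
Qed.

Lemma Csum_n_plus (u v : nat -> C) (n : nat) :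
  (sum_n (fun k => u k + v k) n : C) = sum_n u n + sum_n v n.
Proof. apply (sum_n_plus u v n). Qed.

(** By induction on [n]: the new factor, multiplied with a term of the sum, splits into the old
    pole and the new one.  The coefficient of the new pole is then the induction hypothesis
    evaluated at that pole. *)
Lemma qpoch_partial_fractions (q x y : C) (n : nat) :
  q <> 0 -> (Cmod q < 1)%R -> x <> 0 -> (forall k, (k <= n)%nat -> y * q ^ k <> 1) ->
  (sum_n (fun k => pfcoef x q n k / (1 - y * q ^ k)) n : C) = qpoch (x * y) q n / qpoch y q (S n).
Proof.
  intros Hq0 Hq Hx. revert y. induction n as [|n IH]; intros y Hy.
  { assert (H0 := one_minus_nz _ (Hy 0%nat (le_n 0))).
    rewrite sum_O. unfold pfcoef. simpl. field.
    intros E. apply H0. simpl. rewrite <- E. ring. }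
  assert (Hn : forall k, (k <= n)%nat -> q ^ (S n - k) <> 1)
    by (intros k Hk; apply Cpow_neq_1; [exact Hq|lia]).
  rewrite sum_Sn. change plus with Cplus.
  assert (HyS := one_minus_nz _ (Hy (S n) (le_n _))).
  rewrite (sum_n_ext_loc _ (fun k =>
    (1 - x * y * q ^ n) / (1 - y * q ^ S n) * (pfcoef x q n k / (1 - y * q ^ k))
    + - ((1 - x / q) / (1 - y * q ^ S n)) * (pfcoef x q n k / (1 - / q ^ S n * q ^ k)))).
  2:{ intros k Hk. assert (Hyk := one_minus_nz _ (Hy k ltac:(lia))).
      assert (Hnk := one_minus_nz _ (Hn k Hk)).
      unfold pfcoef. replace (S n - k)%nat with (S (n - k)) by lia. rewrite !qpoch_S.
      replace (S n - k)%nat with (S (n - k)) in Hnk by lia.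
      assert (Hk1 := qpoch_qq_nz q k Hq). assert (Hk2 := qpoch_qq_nz q (n - k) Hq).
      replace (q ^ S n) with (q * (q ^ (n - k) * q ^ k)) in *
        by (rewrite <- Cpow_add_r, Nat.sub_add by exact Hk; reflexivity).
      replace (q ^ n) with (q ^ (n - k) * q ^ k) in *
        by (rewrite <- Cpow_add_r, Nat.sub_add by exact Hk; reflexivity).
      rewrite Cpow_S in Hnk.
      assert (Hz1 := Cpow_nz q k Hq0). assert (Hz2 := Cpow_nz q (n - k) Hq0).
      revert Hyk Hnk Hk1 Hk2 Hz1 Hz2 HyS.
      generalize (q ^ (n - k)) (q ^ k) (qpoch q q k) (qpoch q q (n - k)) (x ^ k)
        (qpoch (q / x) q k) (qpoch x q (n - k)). intros.
      C_eq.
      field. repeat split; try assumption.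
      apply Csub_nz_sym, Hnk. }
  rewrite Csum_n_plus, !Csum_n_scal.
  rewrite IH by (intros k Hk; apply Hy; lia).
  rewrite IH.
  2:{ intros k Hk E. apply (Hn k Hk).
      transitivity (/ q ^ S n * q ^ k * q ^ (S n - k)); [rewrite E; ring|].
      replace (/ q ^ S n * q ^ k * q ^ (S n - k)) with (/ q ^ S n * (q ^ (S n - k) * q ^ k)) by ring.
      rewrite <- Cpow_add_r, Nat.sub_add by lia. apply Cinv_l, Cpow_nz, Hq0. }
  (* The value found at the pole [q^(-n-1)] has negative powers of [q]; reflection turns it into
     the last coefficient. *)
  destruct (qpoch_reflect q (S n) Hq0) as [G [HG HGw]].
  assert (E1 := HGw x Hx). assert (E2 := HGw 1 C1_nz).
  rewrite Cpow_1_l, Cmult_1_l in E2. replace (q / 1) with q in E2 by field.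
  replace (1 / q ^ S n) with (/ q ^ S n) in E2 by (unfold Cdiv; ring).
  unfold pfcoef. rewrite Nat.sub_diag. simpl (qpoch _ _ 0).
  rewrite <- E1, <- E2. rewrite (qpoch_S (x / q ^ S n)).
  replace (x / q ^ S n * q ^ n) with (x / q)
    by (simpl; field; split; [apply Cpow_nz|]; exact Hq0).
  replace (x * / q ^ S n) with (x / q ^ S n) by reflexivity.
  assert (HP : qpoch (/ q ^ S n) q (S n) <> 0).
  { intros E. rewrite E, Cmult_0_l in E2. apply (qpoch_qq_nz q (S n) Hq). symmetry. exact E2. }
  assert (HPy : qpoch y q (S n) <> 0) by (apply qpoch_nz; intros k Hk; apply Hy; lia).
  rewrite (qpoch_S (x * y)), (qpoch_S y q (S n)).
  revert HP HPy HyS HG.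
  generalize (qpoch (/ q ^ S n) q (S n)) (qpoch (x / q ^ S n) q n) (qpoch y q (S n))
    (qpoch (x * y) q n) (q ^ S n) (q ^ n).
  intros. field. repeat split; assumption.
Qed.

Lemma Csum_n_head (u : nat -> C) (n : nat) :
  (sum_n u (S n) : C) = u 0%nat + sum_n (fun k => u (S k)) n.
Proof.
  induction n as [|n IH]; [rewrite sum_Sn, !sum_O; reflexivity|].
  rewrite sum_Sn, IH, sum_Sn. change plus with Cplus. ring.
Qed.

Lemma zsum_sum_n (h : Z -> C) (N : nat) :
  zsum h N = sum_n (fun k => h (Z.of_nat k - Z.of_nat N)%Z) (2 * N).
Proof.
  induction N as [|N IH]; [rewrite sum_O; reflexivity|].
  replace (2 * S N)%nat with (S (S (2 * N))) by lia.
  rewrite sum_Sn, Csum_n_head. change plus with Cplus.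
  rewrite (sum_n_ext _ (fun k => h (Z.of_nat k - Z.of_nat N)%Z)).
  - rewrite <- IH, zsum_S.
    replace (Z.of_nat (S (S (2 * N))) - Z.of_nat (S N))%Z with (Z.of_nat (S N)) by lia.
    replace (Z.of_nat 0 - Z.of_nat (S N))%Z with (- Z.of_nat (S N))%Z by lia. ring.
  - intros k. f_equal. lia.
Qed.

Definition theta (q x : C) : C := qpoch_inf x q * qpoch_inf (q / x) q.

Lemma theta_nz (q x : C) : q <> 0 -> (Cmod q < 1)%R -> x <> 0 ->
  (forall z, x * zpow q z <> 1) -> theta q x <> 0.
Proof.
  intros Hq0 Hq Hx0 Hx. apply Cmult_neq_0; apply qpoch_inf_nz; try exact Hq; intros k.
  - rewrite <- zpow_nat. apply Hx.
  - intros E. apply (Hx (- Z.of_nat (S k))%Z). rewrite zpow_opp_nat.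
    assert (Hk := Cpow_nz q k Hq0).
    transitivity (/ (q / x * q ^ k)).
    + rewrite Cpow_S. field. repeat split; assumption.
    + rewrite E. field.
Qed.

(** The domain of convergence of the bilateral sum of Kronecker in its first variable. *)
Definition annulus (q x : C) : Prop := (Cmod q < Cmod x < 1)%R.

Lemma annulus_nz (q x : C) : annulus q x -> x <> 0.
Proof. intros [H _] E. rewrite E, Cmod_0 in H. pose proof (Cmod_ge_0 q). lra. Qed.

Lemma annulus_inv (q x : C) : q <> 0 -> annulus q x -> annulus q (q / x).
Proof.
  intros Hq Hx. assert (Hx0 := annulus_nz _ _ Hx). destruct Hx as [H1 H2].
  assert (Hq' := proj1 (Cmod_gt_0 q) Hq).
  assert (Hx' := proj1 (Cmod_gt_0 x) Hx0).
  unfold annulus. rewrite Cmod_div by exact Hx0. split.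
  - apply Rmult_lt_reg_r with (Cmod x); [exact Hx'|].
    unfold Rdiv. rewrite Rmult_assoc, Rinv_l by lra. nra.
  - apply Rmult_lt_reg_r with (Cmod x); [exact Hx'|].
    unfold Rdiv. rewrite Rmult_assoc, Rinv_l by lra. lra.
Qed.

Lemma annulus_zpow (q x : C) (z : Z) : q <> 0 -> annulus q x -> x * zpow q z <> 1.
Proof.
  intros Hq Hx. assert (Hx0 := annulus_nz _ _ Hx). destruct Hx as [H1 H2].
  assert (Hq1 : (Cmod q < 1)%R) by lra.
  revert z. apply Z_nat_cases; intros n E.
  - rewrite zpow_nat in E. apply (f_equal Cmod) in E. rewrite Cmod_mult, Cmod_1 in E.
    assert (H := Cmod_pow_le1 q n Hq1). pose proof (Cmod_ge_0 (q ^ n)).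
    pose proof (Cmod_ge_0 x). nra.
  - rewrite zpow_opp_nat in E.
    assert (E' : x = q ^ n).
    { rewrite <- (Cmult_1_l (q ^ n)), <- E. field. apply Cpow_nz, Hq. }
    destruct n as [|n].
    + rewrite E' in H2. simpl in H2. rewrite Cmod_1 in H2. lra.
    + rewrite E' in H1. simpl in H1. rewrite Cmod_mult in H1.
      assert (H := Cmod_pow_le1 q n Hq1). pose proof (Cmod_ge_0 q). nra.
Qed.

Lemma geom_factor_away (q u : C) : (Cmod q < 1)%R -> (forall k, u * q ^ k <> 1) ->
  exists M, (0 < M)%R /\ forall k, (Cmod (/ (1 - u * q ^ k)) <= M)%R.
Proof.
  intros Hq Hu. apply (tends_away _ (RtoC 1)).
  - exact C1_nz.
  - intros n. apply one_minus_nz, Hu.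
  - replace (RtoC 1) with (1 - u * 0) at 1 by ring.
    apply tends_minus; [apply tends_const|apply tends_scal, tends_geom, Hq].
Qed.

Definition zfactor (q y : C) (z : Z) : C := / (1 - y * zpow q z).

(** The expression at negative exponents in which numerator and denominator are both controlled:
    the factor decays like [q^n]. *)
Lemma zfactor_neg (q y : C) (n : nat) : q <> 0 -> y <> 0 -> (forall z, y * zpow q z <> 1) ->
  zfactor q y (- Z.of_nat n) = - / y * q ^ n * / (1 - / y * q ^ n) /\ / y * q ^ n <> 1.
Proof.
  intros Hq Hy0 Hy. unfold zfactor. specialize (Hy (- Z.of_nat n)%Z).
  rewrite zpow_opp_nat in *. assert (Hn := Cpow_nz q n Hq).
  assert (H : / y * q ^ n <> 1).
  { intros E. apply Hy. rewrite <- (Cinv_inv y Hy0).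
    transitivity (/ (/ y * q ^ n)); [field; repeat split; try assumption|rewrite E; field]. }
  split; [|exact H].
  assert (H1 := one_minus_nz _ Hy). assert (H2 := one_minus_nz _ H).
  field. repeat split; try assumption.
  - intros E. apply H2. apply (Cmult_cancel_r y); [exact Hy0|]. rewrite Cmult_0_l, <- E. field. exact Hy0.
  - intros E. apply H1. apply (Cmult_cancel_r (q ^ n)); [exact Hn|]. rewrite Cmult_0_l, <- E. field. exact Hn.
Qed.

(** The two directions behave differently: bounded for positive exponents, geometric decay for
    negative ones. *)
Lemma zfactor_bound (q y : C) : q <> 0 -> (Cmod q < 1)%R -> y <> 0 ->
  (forall z, y * zpow q z <> 1) ->
  exists M, (0 < M)%R /\ (forall n, Cmod (zfactor q y (Z.of_nat n)) <= M)%R /\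
    (forall n, Cmod (zfactor q y (- Z.of_nat n)) <= M * Cmod q ^ n)%R.
Proof.
  intros Hq0 Hq Hy0 Hy.
  destruct (geom_factor_away q y Hq) as [M1 [HM1 H1]].
  { intros k. rewrite <- zpow_nat. apply Hy. }
  destruct (geom_factor_away q (/ y) Hq) as [M2 [HM2 H2]].
  { intros k. apply (zfactor_neg q y k Hq0 Hy0 Hy). }
  assert (Hy' := proj1 (Cmod_gt_0 _) (Cinv_neq_0 y Hy0)).
  assert (HP : (0 < Cmod (/ y) * M2)%R) by (apply Rmult_lt_0_compat; assumption).
  exists (M1 + Cmod (/ y) * M2)%R. split; [lra|]. split; intros n.
  - unfold zfactor. rewrite zpow_nat. specialize (H1 n). lra.
  - rewrite (proj1 (zfactor_neg q y n Hq0 Hy0 Hy)).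
    rewrite !Cmod_mult, Cmod_opp, Cmod_pow.
    assert (Hqn : (0 <= Cmod q ^ n)%R) by (apply pow_le, Cmod_ge_0).
    replace (Cmod (/ y) * Cmod q ^ n * Cmod (/ (1 - / y * q ^ n)))%R
      with (Cmod (/ y) * Cmod (/ (1 - / y * q ^ n)) * Cmod q ^ n)%R by ring.
    apply Rmult_le_compat_r; [exact Hqn|].
    assert (Cmod (/ y) * Cmod (/ (1 - / y * q ^ n)) <= Cmod (/ y) * M2)%R
      by (apply Rmult_le_compat_l; [lra|apply H2]).
    lra.
Qed.

(** The ratio of decay is [|x|] for positive indices and [|q/x|] for negative ones. *)
Definition kron_radius (q x : C) : R := Rmax (Cmod x) (Cmod (q / x)).

Lemma kron_radius_bounds (q x : C) : q <> 0 -> annulus q x -> (0 <= kron_radius q x < 1)%R.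
Proof.
  intros Hq Hx. destruct (annulus_inv q x Hq Hx) as [_ H]. destruct Hx as [H1 H2].
  unfold kron_radius. split.
  - apply Rle_trans with (Cmod x); [apply Cmod_ge_0|apply Rmax_l].
  - apply Rmax_lub_lt; assumption.
Qed.

Lemma kron_decays (q x y : C) : q <> 0 -> annulus q x -> y <> 0 ->
  (forall z, y * zpow q z <> 1) ->
  exists M, decays M (kron_radius q x) (fun z => zpow x z * zfactor q y z).
Proof.
  intros Hq0 Hx Hy0 Hy. assert (Hx0 := annulus_nz _ _ Hx).
  assert (Hq : (Cmod q < 1)%R) by (destruct Hx; lra).
  destruct (zfactor_bound q y Hq0 Hq Hy0 Hy) as [M [HM [H1 H2]]].
  assert (Hr := kron_radius_bounds q x Hq0 Hx).
  exists M. intros z. revert z. apply Z_nat_cases; intros n.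
  - rewrite zpow_nat, Cmod_mult, Cmod_pow, Zabs2Nat.id, Rmult_comm.
    apply Rmult_le_compat; [apply Cmod_ge_0|apply pow_le, Cmod_ge_0|apply H1|].
    apply pow_incr. split; [apply Cmod_ge_0|apply Rmax_l].
  - rewrite zpow_opp_nat, Cmod_mult.
    replace (Z.abs_nat (- Z.of_nat n)) with n by lia.
    apply Rle_trans with (Cmod (/ x ^ n) * (M * Cmod q ^ n))%R.
    { apply Rmult_le_compat_l; [apply Cmod_ge_0|apply H2]. }
    replace (Cmod (/ x ^ n) * (M * Cmod q ^ n))%R with (M * Cmod (q / x) ^ n)%R.
    + apply Rmult_le_compat_l; [lra|]. apply pow_incr.
      split; [apply Cmod_ge_0|apply Rmax_r].
    + rewrite <- !Cmod_pow. unfold Cdiv. rewrite Cpow_mult_l, Cpow_inv by exact Hx0.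
      rewrite Cmod_mult. ring.
Qed.

(** Substituting [y q^(-N)] for [y] in the partial fractions of order [2N] makes the poles
    symmetric; after division by [x^N] each coefficient converges, and they are uniformly
    dominated. *)
Lemma kronecker (q x y : C) : q <> 0 -> annulus q x -> y <> 0 ->
  (forall z, y * zpow q z <> 1) ->
  is_zsum (fun z => zpow x z * zfactor q y z)
    (qpoch_inf q q ^ 2 * theta q (x * y) / (theta q x * theta q y)).
Proof.
  intros Hq0 Hx Hy0 Hy. assert (Hx0 := annulus_nz _ _ Hx).
  assert (Hq : (Cmod q < 1)%R) by (destruct Hx; lra).
  destruct (kron_decays q x y Hq0 Hx Hy0 Hy) as [M HM].
  assert (Hr := kron_radius_bounds q x Hq0 Hx).
  assert (Hqq : qpoch_inf q q <> 0).
  { apply qpoch_inf_nz; [exact Hq|]. intros k. rewrite <- Cpow_S. apply Cpow_neq_1; [exact Hq|lia]. }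
  assert (Htx := theta_nz q x Hq0 Hq Hx0 (fun z => annulus_zpow q x z Hq0 Hx)).
  assert (Hty := theta_nz q y Hq0 Hq Hy0 Hy).
  set (f := fun (N : nat) (z : Z) =>
    (qpoch (q / x) q (Z.to_nat (Z.of_nat N + z)) * qpoch x q (Z.to_nat (Z.of_nat N - z))
     / (qpoch q q (Z.to_nat (Z.of_nat N + z)) * qpoch q q (Z.to_nat (Z.of_nat N - z))))
    * (zpow x z * zfactor q y z)).
  set (T := theta q x / qpoch_inf q q ^ 2).
  destruct (tends_bounded _ _ (qpoch_tends (q / x) q Hq)) as [B1 [B1p HB1]].
  destruct (tends_bounded _ _ (qpoch_tends x q Hq)) as [B2 [B2p HB2]].
  destruct (tends_away _ _ Hqq (fun n => qpoch_qq_nz q n Hq) (qpoch_tends q q Hq))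
    as [B3 [B3p HB3]].
  destruct (tannery (B1 * B2 * (B3 * B3) * M) (kron_radius q x) f
    (fun z => T * (zpow x z * zfactor q y z)) Hr) as [l [Hl Hfl]].
  { intros N z. unfold f. rewrite Cmod_mult, Rmult_assoc.
    apply Rmult_le_compat; [apply Cmod_ge_0|apply Cmod_ge_0| |apply HM].
    set (i := Z.to_nat _). set (j := Z.to_nat (_ - z)).
    replace (qpoch (q / x) q i * qpoch x q j / (qpoch q q i * qpoch q q j))
      with (qpoch (q / x) q i * qpoch x q j * (/ qpoch q q i * / qpoch q q j))
      by (field; split; apply qpoch_qq_nz, Hq).
    rewrite !Cmod_mult.
    apply Rmult_le_compat; try (apply Rmult_le_pos; apply Cmod_ge_0);
      apply Rmult_le_compat; auto using Cmod_ge_0. }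
  { intros z. apply tends_mult; [|apply tends_const].
    unfold T, theta. replace (qpoch_inf q q ^ 2) with (qpoch_inf q q * qpoch_inf q q) by ring.
    rewrite (Cmult_comm (qpoch_inf x q)).
    apply tends_div.
    - apply Cmult_neq_0; exact Hqq.
    - intros n. apply Cmult_neq_0; apply qpoch_qq_nz, Hq.
    - apply tends_mult.
      + apply (tends_subseq _ _ (fun N => Z.to_nat (Z.of_nat N + z)) (Z.abs_nat z));
          [intros; lia|apply qpoch_tends, Hq].
      + apply (tends_subseq _ _ (fun N => Z.to_nat (Z.of_nat N - z)) (Z.abs_nat z));
          [intros; lia|apply qpoch_tends, Hq].
    - apply tends_mult.
      + apply (tends_subseq _ _ (fun N => Z.to_nat (Z.of_nat N + z)) (Z.abs_nat z));
          [intros; lia|apply qpoch_tends, Hq].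
      + apply (tends_subseq _ _ (fun N => Z.to_nat (Z.of_nat N - z)) (Z.abs_nat z));
          [intros; lia|apply qpoch_tends, Hq]. }
  (* The poles [q^(-k)], [0 <= k <= 2N], become [q^(-z)], [-N <= z <= N], with [k = N + z]. *)
  assert (Hfin : forall N, zsum (f N) N
    = qpoch (x * y) q N * qpoch (q / (x * y)) q N / (qpoch y q (S N) * qpoch (q / y) q N)).
  { intros N. rewrite zsum_sum_n.
    assert (HxN := Cpow_nz x N Hx0). assert (HqN := Cpow_nz q N Hq0).
    assert (HyN : forall k, y / q ^ N * q ^ k <> 1).
    { intros k. specialize (Hy (Z.of_nat k - Z.of_nat N)%Z).
      unfold Z.sub in Hy. rewrite zpow_add, zpow_nat, zpow_opp_nat in Hy by exact Hq0.
      intros E. apply Hy. rewrite <- E. field. exact HqN. }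
    rewrite (sum_n_ext_loc _ (fun k =>
      / x ^ N * (pfcoef x q (2 * N) k / (1 - y / q ^ N * q ^ k)))).
    2:{ intros k Hk. unfold f, pfcoef, zfactor.
        replace (Z.to_nat (Z.of_nat N + (Z.of_nat k - Z.of_nat N))) with k by lia.
        replace (Z.to_nat (Z.of_nat N - (Z.of_nat k - Z.of_nat N))) with (2 * N - k)%nat by lia.
        unfold Z.sub. rewrite !zpow_add, !zpow_nat, !zpow_opp_nat by assumption.
        replace (y * (q ^ k * / q ^ N)) with (y / q ^ N * q ^ k) by (unfold Cdiv; ring).
        assert (Hf := one_minus_nz _ (HyN k)).
        assert (Hk1 := qpoch_qq_nz q k Hq). assert (Hk2 := qpoch_qq_nz q (2 * N - k) Hq).
        revert HxN Hf Hk1 Hk2.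
        generalize (1 - y / q ^ N * q ^ k) (qpoch q q k) (qpoch q q (2 * N - k)) (x ^ N) (x ^ k)
         (qpoch (q / x) q k) (qpoch x q (2 * N - k)).
        intros. C_eq. field. repeat split; assumption. }
    rewrite Csum_n_scal, qpoch_partial_fractions by auto.
    replace (2 * N)%nat with (N + N)%nat by lia.
    replace (S (N + N)) with (N + S N)%nat by lia.
    rewrite !qpoch_plus.
    replace (x * (y / q ^ N)) with ((x * y) / q ^ N) by (field; exact HqN).
    replace (x * y / q ^ N * q ^ N) with (x * y) by (field; exact HqN).
    replace (y / q ^ N * q ^ N) with y by (field; exact HqN).
    destruct (qpoch_reflect q N Hq0) as [G [HG HGw]].
    assert (E1 := HGw (x * y) (Cmult_neq_0 _ _ Hx0 Hy0)). assert (E2 := HGw y Hy0).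
    assert (H1 : qpoch (y / q ^ N) q N <> 0) by (apply qpoch_nz; intros k _; apply HyN).
    assert (H2 : qpoch y q (S N) <> 0).
    { apply qpoch_nz. intros k _. rewrite <- zpow_nat. apply Hy. }
    assert (HyN0 := Cpow_nz y N Hy0).
    assert (H3 : qpoch (q / y) q N <> 0).
    { intros E. rewrite E in E2. apply (Cmult_neq_0 _ _ H1 HG). rewrite E2. ring. }
    replace (qpoch (x * y / q ^ N) q N) with ((x * y) ^ N * qpoch (q / (x * y)) q N / G)
      by (rewrite <- E1; field; exact HG).
    replace (qpoch (y / q ^ N) q N) with (y ^ N * qpoch (q / y) q N / G)
      by (rewrite <- E2; field; exact HG).
    rewrite Cpow_mult_l. revert HG H2 H3 HxN HyN0.
    generalize (qpoch (q / y) q N) (qpoch y q (S N)) (x ^ N) (y ^ N).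
    intros. field. repeat split; assumption. }
  assert (HL : l = theta q (x * y) / theta q y).
  { apply (tends_unique _ _ _ Hfl). apply (tends_ext _ _ _ (fun N => eq_sym (Hfin N))).
    apply tends_div.
    - exact Hty.
    - intros N. apply Cmult_neq_0; apply qpoch_nz; intros k _.
      + rewrite <- zpow_nat. apply Hy.
      + intros E. apply (proj2 (zfactor_neg q y (S k) Hq0 Hy0 Hy)).
        rewrite <- E, Cpow_S. unfold Cdiv. ring.
    - apply tends_mult; apply qpoch_tends, Hq.
    - apply tends_mult; [|apply qpoch_tends, Hq].
      apply (tends_subseq _ _ S 0); [intros; lia|apply qpoch_tends, Hq]. }
  assert (HT : T <> 0) by (apply Cdiv_neq_0; [exact Htx|apply Cpow_nz, Hqq]).
  replace (qpoch_inf q q ^ 2 * theta q (x * y) / (theta q x * theta q y)) with (/ T * l).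
  - apply is_zsum_ext with (fun z => / T * (T * (zpow x z * zfactor q y z))).
    + intros z. field. exact HT.
    + apply is_zsum_scal, Hl.
  - rewrite HL. unfold T. field. repeat split; assumption.
Qed.

(** * Differences of Lambert sums as products *)

(** Summed over the translates of [x], this is the Weierstrass function up to constants, written
    in the exponential of its argument. *)
Definition lam (x : C) : C := x / (1 - x) ^ 2.

Definition off_lattice (q y : C) : Prop := y <> 0 /\ forall z, y * zpow q z <> 1.

Lemma annulus_off_lattice (q x : C) : q <> 0 -> annulus q x -> off_lattice q x.
Proof.
  intros Hq Hx. split; [exact (annulus_nz _ _ Hx)|]. intros z. apply annulus_zpow; assumption.
Qed.

Lemma off_lattice_shift (q y : C) (e : Z) :
  q <> 0 -> off_lattice q y -> off_lattice q (y * zpow q e).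
Proof.
  intros Hq [Hy0 Hy]. split; [apply Cmult_neq_0; [exact Hy0|apply zpow_nz, Hq]|].
  intros z. rewrite <- Cmult_assoc, <- zpow_add by exact Hq. apply Hy.
Qed.

Lemma lam_zfactor (q y : C) (z : Z) : off_lattice q y ->
  lam (y * zpow q z) = y * (zpow q z * zfactor q y z * zfactor q y z).
Proof.
  intros [Hy0 Hy]. unfold lam, zfactor. assert (H := one_minus_nz _ (Hy z)). field. exact H.
Qed.

(** At negative exponents the two powers of [zfactor] decay twice as fast as [zpow q z] grows. *)
Lemma lam_decays (q y : C) : q <> 0 -> (Cmod q < 1)%R -> off_lattice q y ->
  exists M, decays M (Cmod q) (fun z => lam (y * zpow q z)).
Proof.
  intros Hq0 Hq Hy. assert (Hq' := proj1 (Cmod_gt_0 q) Hq0).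
  destruct (zfactor_bound q y Hq0 Hq (proj1 Hy) (proj2 Hy)) as [M [HM [H1 H2]]].
  exists (Cmod y * (M * M))%R. intros z. rewrite (lam_zfactor _ _ _ Hy). revert z.
  apply Z_nat_cases; intros n; rewrite !Cmod_mult, (Rmult_assoc (Cmod y) (M * M));
    (apply Rmult_le_compat_l; [apply Cmod_ge_0|]).
  - rewrite zpow_nat, Cmod_pow, Zabs2Nat.id. specialize (H1 n).
    set (t := Cmod (zfactor _ _ _)) in *. assert (0 <= t)%R by apply Cmod_ge_0.
    assert (0 <= Cmod q ^ n)%R by (apply pow_le; lra).
    rewrite (Rmult_comm (M * M)), Rmult_assoc. apply Rmult_le_compat_l; [assumption|].
    apply Rmult_le_compat; lra.
  - rewrite zpow_opp_nat, Cmod_inv, Cmod_pow by (apply Cpow_nz, Hq0).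
    replace (Z.abs_nat (- Z.of_nat n)) with n by lia. specialize (H2 n).
    set (t := Cmod (zfactor _ _ _)) in *. assert (0 <= t)%R by apply Cmod_ge_0.
    assert (Hp : (0 < Cmod q ^ n)%R) by (apply pow_lt; lra).
    apply Rmult_le_reg_l with (Cmod q ^ n)%R; [exact Hp|].
    replace (Cmod q ^ n * (/ Cmod q ^ n * t * t))%R with (t * t)%R by (field; lra).
    replace (Cmod q ^ n * (M * M * Cmod q ^ n))%R
      with ((M * Cmod q ^ n) * (M * Cmod q ^ n))%R by ring.
    apply Rmult_le_compat; assumption.
Qed.

Lemma lam_cvg (q y : C) : q <> 0 -> (Cmod q < 1)%R -> off_lattice q y ->
  exists l, is_zsum (fun z => lam (y * zpow q z)) l.
Proof.
  intros Hq0 Hq Hy. destruct (lam_decays q y Hq0 Hq Hy) as [M HM].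
  apply (decays_cvg _ _ _ (conj (Cmod_ge_0 q) Hq) HM).
Qed.

Lemma zfactor_shift (q y : C) (z e : Z) : q <> 0 ->
  zfactor q y (z + e) = zfactor q (y * zpow q e) z.
Proof.
  intros Hq. unfold zfactor. rewrite zpow_add by exact Hq. do 2 f_equal. ring.
Qed.

Lemma zfactor_tends_1 (q y : C) : (Cmod q < 1)%R -> off_lattice q y ->
  tends (fun n => zfactor q y (Z.of_nat n)) 1.
Proof.
  intros Hq [Hy0 Hy]. replace (RtoC 1) with (/ (1 - y * 0)) by field.
  apply tends_inv.
  - replace (1 - y * 0) with (RtoC 1) by ring. exact C1_nz.
  - intros n. apply one_minus_nz, Hy.
  - apply tends_minus; [apply tends_const|]. apply tends_scal.
    apply tends_ext with (fun n => q ^ n); [intros n; symmetry; apply zpow_nat|].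
    apply tends_geom, Hq.
Qed.

Lemma zfactor_tends_0 (q y : C) : q <> 0 -> (Cmod q < 1)%R -> off_lattice q y ->
  tends (fun n => zfactor q y (- Z.of_nat n)) 0.
Proof.
  intros Hq0 Hq [Hy0 Hy]. destruct (zfactor_bound q y Hq0 Hq Hy0 Hy) as [M [HM [_ H]]].
  apply tends_squeeze with (fun n => M * Cmod q ^ n)%R.
  - intros n. replace (zfactor q y (- Z.of_nat n) - 0) with (zfactor q y (- Z.of_nat n)) by ring.
    apply H.
  - replace (Finite 0) with (Finite (M * 0)) by (f_equal; ring).
    apply (is_lim_seq_scal_l _ M 0). apply is_lim_seq_geom.
    rewrite Rabs_pos_eq; [exact Hq|apply Cmod_ge_0].
Qed.

(** The term is a constant multiple of [zfactor q y n - zfactor q y (n + d)], and [zfactor] goes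
    from 0 at minus infinity to 1 at plus infinity. *)
Lemma kron_diagonal (q y : C) (d : Z) :
  q <> 0 -> (Cmod q < 1)%R -> off_lattice q y -> d <> 0%Z ->
  is_zsum (fun n => zpow q n * zfactor q y n * zfactor q y (n + d))
    (- IZR d / (y * (1 - zpow q d))).
Proof.
  intros Hq0 Hq Hy Hd.
  assert (Hqd := one_minus_nz _ (zpow_neq_1 q d Hq0 Hq Hd)).
  assert (Hy0 := proj1 Hy).
  replace (- IZR d / (y * (1 - zpow q d)))
    with (/ (y * (1 - zpow q d)) * (IZR d * (0 - 1))) by (field; split; assumption).
  apply is_zsum_ext with
    (fun n => / (y * (1 - zpow q d)) * (zfactor q y n - zfactor q y (n + d))).
  - intros n. assert (H1 := one_minus_nz _ (proj2 Hy n)).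
    assert (H2 := one_minus_nz _ (proj2 Hy (n + d)%Z)).
    unfold zfactor. rewrite zpow_add in * by exact Hq0.
    field. repeat split; assumption.
  - apply is_zsum_scal, is_zsum_telescope; intros e.
    + apply tends_ext with (fun n => zfactor q (y * zpow q e) (Z.of_nat n)).
      * intros n. symmetry. apply zfactor_shift, Hq0.
      * apply zfactor_tends_1; [exact Hq|apply off_lattice_shift; assumption].
    + apply tends_ext with (fun n => zfactor q (y * zpow q e) (- Z.of_nat n)).
      * intros n. symmetry. apply zfactor_shift, Hq0.
      * apply zfactor_tends_0; [exact Hq0|exact Hq|apply off_lattice_shift; assumption].
Qed.

Lemma sqrt_pow_split (r : R) (a b c : nat) : (0 <= r < 1)%R -> (b + c <= 2 * a)%nat ->
  (r ^ a <= sqrt r ^ b * sqrt r ^ c)%R.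
Proof.
  intros Hr H. rewrite <- pow_add.
  assert (Hs0 := sqrt_pos r).
  assert (Hs1 : (sqrt r < 1)%R) by (rewrite <- sqrt_1; apply sqrt_lt_1; lra).
  rewrite <- (sqrt_sqrt r) at 1 by lra.
  replace (sqrt r * sqrt r)%R with (sqrt r ^ 2)%R by ring. rewrite <- pow_mult.
  replace (2 * a)%nat with (b + c + (2 * a - (b + c)))%nat by lia.
  rewrite (pow_add _ (b + c)). rewrite <- (Rmult_1_r (sqrt r ^ (b + c))) at 2.
  apply Rmult_le_compat_l; [apply pow_le; lra|].
  rewrite <- (pow1 (2 * a - (b + c))). apply pow_incr. lra.
Qed.

(** The index zero is excluded because [1 - zpow q 0] vanishes. *)
Definition lambert_tail (q x : C) (d : Z) : C :=
  if Z.eqb d 0 then 0 else IZR d * zpow x d / (1 - zpow q d).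

(** The product of the Kronecker sums at [x] and [q/x], summed by diagonals: the main diagonal
    is the bilateral sum at [y] divided by [y], and the others telescope.  What matters is that
    the sum of [lambert_tail q x] does not involve [y]. *)
Lemma kron_product (q x y Ky Kqy Fy : C) : q <> 0 -> annulus q x -> off_lattice q y ->
  is_zsum (fun z => zpow x z * zfactor q y z) Ky ->
  is_zsum (fun z => zpow (q / x) z * zfactor q y z) Kqy ->
  is_zsum (fun z => lam (y * zpow q z)) Fy ->
  is_zsum (lambert_tail q x) (Fy - y * (Ky * Kqy)).
Proof.
  intros Hq0 Hx Hy HK HK' HF. assert (Hx0 := annulus_nz _ _ Hx).
  assert (Hq : (Cmod q < 1)%R) by (destruct Hx; lra).
  assert (Hx' := annulus_inv q x Hq0 Hx). assert (Hqx0 := annulus_nz _ _ Hx').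
  assert (Hy0 := proj1 Hy).
  destruct (kron_decays q x y Hq0 Hx Hy0 (proj2 Hy)) as [M1 HM1].
  destruct (kron_decays q (q / x) y Hq0 Hx' Hy0 (proj2 Hy)) as [M2 HM2].
  assert (Er : kron_radius q (q / x) = kron_radius q x).
  { unfold kron_radius. rewrite Rmax_comm. do 2 f_equal. field. split; assumption. }
  rewrite Er in HM2.
  assert (Hr := kron_radius_bounds q x Hq0 Hx). set (r := kron_radius q x) in *.
  set (a := fun n d : Z =>
    (zpow (q / x) n * zfactor q y n) * (zpow x (n + d) * zfactor q y (n + d))).
  assert (Ea : forall n d, a n d = zpow x d * (zpow q n * zfactor q y n * zfactor q y (n + d))).
  { intros n d. unfold a. rewrite (zpow_add x) by exact Hx0.
    replace (zpow q n) with (zpow (q / x) n * zpow x n); [ring|].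
    rewrite <- zpow_mult_l by assumption. f_equal. field. exact Hx0. }
  assert (HM1p := decays_nonneg _ _ _ HM1). assert (HM2p := decays_nonneg _ _ _ HM2).
  set (diag0 := / y * Fy).
  (* [|n| + |n + d|] is at least [|n|] and [|d|], hence half of their sum: this is the reason
     for the square root of the radius. *)
  destruct (fubini (M1 * M2) (sqrt r) a
    (fun n => (zpow (q / x) n * zfactor q y n) * Ky)
    (fun d => if Z.eqb d 0 then diag0 else - / y * lambert_tail q x d)) as [l [Hl1 Hl2]].
  - split; [apply sqrt_pos|]. rewrite <- sqrt_1. apply sqrt_lt_1; lra.
  - intros n d. unfold a. rewrite Cmod_mult.
    apply Rle_trans with ((M2 * r ^ Z.abs_nat n) * (M1 * r ^ Z.abs_nat (n + d)))%R.
    + apply Rmult_le_compat; try apply Cmod_ge_0; [apply HM2|apply HM1].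
    + replace ((M2 * r ^ Z.abs_nat n) * (M1 * r ^ Z.abs_nat (n + d)))%R
        with (M1 * M2 * r ^ (Z.abs_nat n + Z.abs_nat (n + d)))%R by (rewrite pow_add; ring).
      rewrite (Rmult_assoc (M1 * M2) (sqrt r ^ _)).
      apply Rmult_le_compat_l; [apply Rmult_le_pos; assumption|].
      apply sqrt_pow_split; [exact Hr|lia].
  - intros n. apply is_zsum_scal.
    apply is_zsum_ext with (fun d => (fun z => zpow x z * zfactor q y z) (d + n)%Z).
    + intros d. cbv beta. rewrite (Z.add_comm d n). reflexivity.
    + exact (is_zsum_shift M1 r (fun z => zpow x z * zfactor q y z) Ky n Hr HM1 HK).
  - intros d. apply is_zsum_ext with
      (fun n => zpow x d * (zpow q n * zfactor q y n * zfactor q y (n + d))).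
    { intros n. symmetry. apply Ea. }
    destruct (Z.eqb_spec d 0) as [->|Hd].
    + apply is_zsum_ext with (fun n => / y * lam (y * zpow q n)); [|apply is_zsum_scal, HF].
      intros n. rewrite (lam_zfactor _ _ _ Hy), Z.add_0_r. simpl. field. exact Hy0.
    + unfold lambert_tail. rewrite (proj2 (Z.eqb_neq d 0) Hd).
      assert (Hqd := one_minus_nz _ (zpow_neq_1 q d Hq0 Hq Hd)).
      replace (- / y * (IZR d * zpow x d / (1 - zpow q d)))
        with (zpow x d * (- IZR d / (y * (1 - zpow q d)))) by (field; split; assumption).
      apply is_zsum_scal, kron_diagonal; assumption.
  - assert (El : l = Ky * Kqy).
    { apply (tends_unique _ _ _ Hl1).
      apply (is_zsum_ext (fun n => Ky * (zpow (q / x) n * zfactor q y n))); [intros; ring|].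
      apply is_zsum_scal, HK'. }
    subst l. apply (is_zsum_set0 _ _ 0) in Hl2. simpl in Hl2.
    apply (is_zsum_scal (- y)) in Hl2.
    replace (- y * (Ky * Kqy - diag0 + 0)) with (Fy - y * (Ky * Kqy)) in Hl2
      by (unfold diag0; field; exact Hy0).
    apply is_zsum_ext with (2 := Hl2). intros d.
    destruct (Z.eqb_spec d 0) as [->|Hd]; [unfold lambert_tail; simpl; ring|field; exact Hy0].
Qed.

Lemma theta_inv (q x : C) : q <> 0 -> x <> 0 -> theta q (q / x) = theta q x.
Proof.
  intros Hq Hx. unfold theta. replace (q / (q / x)) with x by (field; split; assumption). ring.
Qed.

Lemma theta_shift (q w : C) : (Cmod q < 1)%R -> q <> 0 -> w <> 0 ->
  theta q (q * w) = - theta q w / w.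
Proof.
  intros Hq Hq0 Hw. unfold theta.
  replace (q / (q * w)) with (/ w) by (field; split; assumption).
  rewrite (qpoch_inf_step w), (qpoch_inf_step (/ w)) by exact Hq.
  replace (w * q) with (q * w) by ring. replace (/ w * q) with (q / w) by (unfold Cdiv; ring).
  field. exact Hw.
Qed.

Lemma theta_1 (q : C) : (Cmod q < 1)%R -> theta q 1 = 0.
Proof. intros Hq. unfold theta. rewrite qpoch_inf_step by exact Hq. ring. Qed.

(** The addition formula of Weierstrass.  The sum of [lambert_tail q x] is computed twice by
    [kron_product]: at [y], and at [x] itself, where the product of theta functions vanishes. *)
Lemma lam_sum_difference (q x y Fx Fy : C) :
  q <> 0 -> annulus q x -> off_lattice q y ->
  is_zsum (fun z => lam (x * zpow q z)) Fx ->
  is_zsum (fun z => lam (y * zpow q z)) Fy ->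
  Fx - Fy = x * theta q (y / x) * theta q (x * y) * qpoch_inf q q ^ 4
    / (theta q x ^ 2 * theta q y ^ 2).
Proof.
  intros Hq0 Hx Hy HFx HFy. assert (Hx0 := annulus_nz _ _ Hx).
  assert (Hq : (Cmod q < 1)%R) by (destruct Hx; lra).
  assert (Hx' := annulus_inv q x Hq0 Hx). assert (Hxl := annulus_off_lattice q x Hq0 Hx).
  assert (Htx := theta_nz q x Hq0 Hq Hx0 (proj2 Hxl)).
  set (P := fun y => x * theta q (y / x) * theta q (x * y) * qpoch_inf q q ^ 4
    / (theta q x ^ 2 * theta q y ^ 2)).
  assert (Main : forall y Fy, off_lattice q y -> is_zsum (fun z => lam (y * zpow q z)) Fy ->
    is_zsum (lambert_tail q x) (Fy + P y)).
  { clear y Fy Hy HFy. intros y Fy [Hy0 Hy] HFy.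
    assert (Hty := theta_nz q y Hq0 Hq Hy0 Hy).
    assert (H := kron_product q x y _ _ _ Hq0 Hx (conj Hy0 Hy)
      (kronecker q x y Hq0 Hx Hy0 Hy) (kronecker q (q / x) y Hq0 Hx' Hy0 Hy) HFy).
    rewrite theta_inv in H by assumption.
    replace (q / x * y) with (q * (y / x)) in H by (unfold Cdiv; ring).
    rewrite theta_shift in H by (try apply Cdiv_neq_0; assumption).
    replace (Fy + P y) with (Fy - y * (qpoch_inf q q ^ 2 * theta q (x * y) / (theta q x * theta q y)
      * (qpoch_inf q q ^ 2 * (- theta q (y / x) / (y / x)) / (theta q x * theta q y)))); [exact H|].
    unfold P. field. repeat split; assumption. }
  assert (E := tends_unique _ _ _ (Main x Fx Hxl HFx) (Main y Fy Hy HFy)).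
  assert (P0 : P x = 0).
  { unfold P. replace (x / x) with (RtoC 1) by (field; exact Hx0).
    rewrite theta_1 by exact Hq. field. exact Htx. }
  rewrite P0 in E. change (Fx - Fy = P y).
  replace Fx with (Fx + 0) by ring. rewrite E. ring.
Qed.

(** * Lambert series *)

Fixpoint psum (f : nat -> C) (N : nat) : C :=
  match N with
  | O => 0
  | S M => psum f M + f (S M)
  end.

Lemma psum_S (f : nat -> C) (N : nat) : psum f (S N) = psum f N + f (S N).
Proof. reflexivity. Qed.

Lemma psum_sum_n_m (f : nat -> C) (N : nat) : psum f N = sum_n_m f 1 N.
Proof.
  induction N as [|N IH]; [rewrite sum_n_m_zero by lia; reflexivity|].
  rewrite psum_S, IH, sum_n_Sm by lia. reflexivity.
Qed.

Lemma psum_ext (f g : nat -> C) (N : nat) :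
  (forall n, (1 <= n)%nat -> f n = g n) -> psum f N = psum g N.
Proof.
  intros E. induction N as [|N IH]; [reflexivity|]. rewrite !psum_S, IH, E by lia. reflexivity.
Qed.

Lemma Csum1_psum (f : nat -> C) (l : C) : tends (psum f) l -> Csum1 f = l.
Proof.
  intros H. apply Clim_correct. apply tends_ext with (2 := H). apply psum_sum_n_m.
Qed.

Lemma Csum1_ext (f g : nat -> C) :
  (forall n, (1 <= n)%nat -> f n = g n) -> (exists l, tends (psum g) l) -> Csum1 f = Csum1 g.
Proof.
  intros E [l Hl]. rewrite (Csum1_psum _ _ Hl). apply Csum1_psum.
  apply tends_ext with (2 := Hl). intros N. symmetry. apply psum_ext, E.
Qed.

Lemma psum_tends (f : nat -> C) : ex_series (fun n => f (S n)) -> tends (psum f) (Csum1 f).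
Proof.
  intros [l Hl]. rewrite (Csum1_correct _ _ Hl).
  apply (tends_subseq (fun n => match n with O => 0 | S m => psum f m end) _ S 0); [intros; lia|].
  apply (filterlim_ext_loc (fun n => sum_n (fun k => f (S k)) (n - 2))).
  - exists 2%nat. intros [|[|n]] Hn; try lia. simpl (_ - _)%nat. rewrite Nat.sub_0_r.
    clear Hn. induction n as [|n IH]; [rewrite sum_O; simpl; ring|].
    rewrite sum_Sn, IH. reflexivity.
  - apply (tends_subseq _ _ (fun n => n - 2)%nat 2); [intros; lia|exact Hl].
Qed.

Definition lambert (q : C) : C := Csum1 (fun n => lam (q ^ n)).
Definition lambert_odd (q : C) : C := Csum1 (fun n => lam (q ^ (2 * n - 1))).

Lemma lambert_tends (q : C) : (Cmod q < 1)%R ->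
  tends (psum (fun n => lam (q ^ n))) (lambert q).
Proof.
  intros Hq. apply psum_tends.
  apply (ex_series_lambert q S S 2 Hq); intros; lia.
Qed.

Lemma lambert_odd_tends (q : C) : (Cmod q < 1)%R ->
  tends (psum (fun n => lam (q ^ (2 * n - 1)))) (lambert_odd q).
Proof.
  intros Hq. apply psum_tends.
  apply (ex_series_lambert q (fun n => 2 * S n - 1)%nat (fun n => 2 * S n - 1)%nat 2 Hq); intros; lia.
Qed.

Lemma psum_term_tends (f : nat -> C) (l : C) :
  tends (psum f) l -> tends (fun n => f (S n)) 0.
Proof.
  intros H. replace (RtoC 0) with (l - l) by ring.
  apply tends_ext with (fun n => psum f (S n) - psum f n); [intros; simpl; ring|].
  apply tends_minus; [apply (tends_subseq _ _ S 0); [intros; lia|]|]; exact H.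
Qed.

Lemma lambert_even_odd (q : C) : (Cmod q < 1)%R ->
  lambert q = lambert (q ^ 2) + lambert_odd q.
Proof.
  intros Hq. apply (tends_unique (fun N => psum (fun n => lam (q ^ n)) (2 * N))).
  - apply (tends_subseq _ _ (fun N => 2 * N)%nat 0); [intros; lia|apply lambert_tends, Hq].
  - apply tends_ext with
      (fun N => psum (fun n => lam ((q ^ 2) ^ n)) N + psum (fun n => lam (q ^ (2 * n - 1))) N).
    + induction n as [|n IH]; [simpl; ring|].
      replace (2 * S n)%nat with (S (S (2 * n))) by lia.
      rewrite !psum_S, <- IH, <- Cpow_mult_r.
      replace (2 * S n - 1)%nat with (S (2 * n)) by lia.
      replace (2 * S n)%nat with (S (S (2 * n))) by lia. ring.
    + apply tends_plus; [apply lambert_tends, (Cmod_pow_lt_1 q 1 Hq)|apply lambert_odd_tends, Hq].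
Qed.

Lemma lam_inv (x : C) : x <> 0 -> x <> 1 -> lam (/ x) = lam x.
Proof.
  intros Hx Hx1. assert (H := one_minus_nz _ Hx1). unfold lam. field.
  repeat split; try assumption. apply Csub_nz_sym, H.
Qed.

Lemma lam_double (x : C) : x <> 1 -> - x <> 1 -> lam x + lam (- x) = 4 * lam (x ^ 2).
Proof.
  intros H1 H2. assert (H1' := one_minus_nz _ H1). assert (H2' := one_minus_nz _ H2).
  assert (H3 : 1 - x ^ 2 <> 0).
  { replace (1 - x ^ 2) with ((1 - x) * (1 - - x)) by ring. apply Cmult_neq_0; assumption. }
  unfold lam. field. repeat split; assumption.
Qed.

(** The sum of [lam] over the cube roots of unity.  After clearing denominators both sides are
    polynomials in [x] and [w], equal modulo [w^2 = - w - 1]. *)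
Lemma lam_triple (x w : C) : w ^ 2 + w + 1 = 0 ->
  x <> 1 -> x * w <> 1 -> x * w ^ 2 <> 1 ->
  lam x + lam (x * w) + lam (x * w ^ 2) = 9 * lam (x ^ 3).
Proof.
  intros Hw H1 H2 H3.
  assert (H1' := one_minus_nz _ H1). assert (H2' := one_minus_nz _ H2).
  assert (H3' := one_minus_nz _ H3).
  assert (Ew : w ^ 2 = - w - 1).
  { replace (w ^ 2) with (w ^ 2 + w + 1 - w - 1) by ring. rewrite Hw. ring. }
  assert (Ew3 : w ^ 3 = 1).
  { replace (w ^ 3) with (1 + (w - 1) * (w ^ 2 + w + 1)) by ring. rewrite Hw. ring. }
  assert (Hx3 : 1 - x ^ 3 = (1 - x) * (1 - x * w) * (1 - x * w ^ 2)).
  { replace ((1 - x) * (1 - x * w) * (1 - x * w ^ 2))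
      with (1 - x ^ 3 * w ^ 3 - x * (1 + w + w ^ 2) + x ^ 2 * (w + w ^ 2 + w ^ 3)
        + x ^ 3 * (w ^ 3 - w ^ 3)) by ring.
    rewrite Ew3, Ew. ring. }
  unfold lam. rewrite Hx3. rewrite Ew in *.
  assert (Ew' : w * w = - w - 1) by (rewrite <- Ew; ring).
  apply (Cmult_cancel_r (((1 - x) * (1 - x * w) * (1 - x * (- w - 1))) ^ 2)).
  { apply Cpow_nz. repeat apply Cmult_neq_0; assumption. }
  transitivity (x * ((1 - x * w) * (1 - x * (- w - 1))) ^ 2
    + x * w * ((1 - x) * (1 - x * (- w - 1))) ^ 2
    + x * (- w - 1) * ((1 - x) * (1 - x * w)) ^ 2); [field; repeat split; assumption|].
  transitivity (9 * x ^ 3); [|field; repeat split; assumption].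
  ring [Ew'].
Qed.

(** * Values of the bilateral sum at torsion points *)

(** For a function symmetric about [-1/2], the terms of index [n] and [- n - 1] agree. *)
Lemma is_zsum_doubled (h : Z -> C) (u : nat -> C) (l : C) :
  (forall n, h (Z.of_nat n) = u (S n)) -> (forall n, h (- Z.of_nat (S n))%Z = u (S n)) ->
  tends (psum u) l -> is_zsum h (2 * l).
Proof.
  intros H1 H2 Hl. replace (2 * l) with (2 * l + 0) by ring.
  apply tends_ext with (fun N => 2 * psum u N + u (S N)).
  - induction n as [|n IH].
    + simpl. assert (H := H1 0%nat). simpl in H. rewrite H. ring.
    + rewrite zsum_S, <- IH, H1, H2, psum_S. ring.
  - apply tends_plus; [apply tends_scal, Hl|exact (psum_term_tends _ _ Hl)].
Qed.

Lemma lam_odd_pos (q : C) (n : nat) :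
  q * zpow (q ^ 2) (Z.of_nat n) = q ^ (2 * S n - 1).
Proof.
  rewrite zpow_nat, <- Cpow_mult_r, <- Cpow_S. f_equal. lia.
Qed.

Lemma lam_odd_neg (q : C) (n : nat) : q <> 0 -> (Cmod q < 1)%R ->
  lam (q * zpow (q ^ 2) (- Z.of_nat (S n))) = lam (q ^ (2 * S n - 1)).
Proof.
  intros Hq0 Hq. rewrite zpow_opp_nat, <- Cpow_mult_r.
  rewrite <- (lam_inv (q ^ (2 * S n - 1))).
  - f_equal. replace (2 * S n)%nat with (S (2 * S n - 1)) at 1 by lia. rewrite Cpow_S.
    field. split; (exact Hq0 || apply Cpow_nz, Hq0).
  - apply Cpow_nz, Hq0.
  - apply Cpow_neq_1; [exact Hq|lia].
Qed.

(** The translates of [q] by powers of [q^2] are the odd powers of [q], and [lam] takes equal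
    values at inverse points. *)
Lemma lam_sum_half (q : C) : q <> 0 -> (Cmod q < 1)%R ->
  is_zsum (fun z => lam (q * zpow (q ^ 2) z)) (2 * lambert_odd q).
Proof.
  intros Hq0 Hq. apply is_zsum_doubled with (fun n => lam (q ^ (2 * n - 1))).
  - intros n. rewrite lam_odd_pos. reflexivity.
  - intros n. apply lam_odd_neg; assumption.
  - apply lambert_odd_tends, Hq.
Qed.

Lemma is_zsum_folded (h : Z -> C) (u : nat -> C) (l : C) :
  (forall n, (1 <= n)%nat -> h (Z.of_nat n) + h (- Z.of_nat n)%Z = u n) ->
  tends (psum u) l -> is_zsum h (h 0%Z + l).
Proof.
  intros H Hl. apply tends_ext with (fun N => h 0%Z + psum u N).
  - induction n as [|n IH]; [simpl; ring|].
    rewrite zsum_S, H, <- IH, psum_S by lia. ring.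
  - apply tends_plus; [apply tends_const|exact Hl].
Qed.

Lemma psum_lin (a b : C) (u v : nat -> C) (N : nat) :
  psum (fun n => a * u n + b * v n) N = a * psum u N + b * psum v N.
Proof. induction N as [|N IH]; simpl; [|rewrite IH]; ring. Qed.

Lemma psum_lin_tends (a b : C) (u v : nat -> C) (l m : C) :
  tends (psum u) l -> tends (psum v) m ->
  tends (psum (fun n => a * u n + b * v n)) (a * l + b * m).
Proof.
  intros Hu Hv. apply tends_ext with (fun N => a * psum u N + b * psum v N).
  - intros N. symmetry. apply psum_lin.
  - apply tends_plus; apply tends_scal; assumption.
Qed.

Lemma Cmod_unit_pow_neq_1 (u p : C) (n : nat) :
  Cmod u = 1%R -> (Cmod p < 1)%R -> (1 <= n)%nat -> u * p ^ n <> 1.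
Proof.
  intros Hu Hp Hn E. apply (f_equal Cmod) in E.
  rewrite Cmod_mult, Hu, Rmult_1_l, Cmod_1 in E.
  destruct n as [|n]; [lia|]. assert (H := Cmod_pow_lt_1 p n Hp). lra.
Qed.

Lemma unit_off_lattice (u p : C) :
  p <> 0 -> (Cmod p < 1)%R -> Cmod u = 1%R -> u <> 1 -> off_lattice p u.
Proof.
  intros Hp0 Hp Hu Hu1. split.
  { intros E. rewrite E, Cmod_0 in Hu. lra. }
  apply Z_nat_cases; intros [|n] E.
  - apply Hu1. rewrite <- E. simpl. ring.
  - rewrite zpow_nat in E. apply (Cmod_unit_pow_neq_1 u p (S n) Hu Hp ltac:(lia) E).
  - apply Hu1. rewrite <- E. simpl. ring.
  - rewrite zpow_opp_nat in E. apply (f_equal Cmod) in E.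
    rewrite Cmod_mult, Hu, Rmult_1_l, Cmod_1, Cmod_inv in E by (apply Cpow_nz, Hp0).
    assert (H := Cmod_pow_lt_1 p n Hp).
    assert (H0 := proj1 (Cmod_gt_0 _) (Cpow_nz p (S n) Hp0)).
    apply (f_equal Rinv) in E. rewrite Rinv_inv, Rinv_1 in E. lra.
Qed.

Lemma m1_neq_1 : - (1) <> RtoC 1.
Proof. intros E. injection E. intros. lra. Qed.

(** The terms of index [n] and [-n] agree, and [lam_double] rewrites them at [p^n] and
    [p^(2n)]. *)
Lemma lam_sum_minus_one (p : C) : p <> 0 -> (Cmod p < 1)%R ->
  is_zsum (fun z => lam (- (1) * zpow p z)) (- (1 / 4) + (8 * lambert (p ^ 2) + - (2) * lambert p)).
Proof.
  intros Hp0 Hp.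
  assert (E0 : lam (- (1) * zpow p 0) = - (1 / 4)).
  { unfold lam. simpl. field. }
  rewrite <- E0.
  apply (is_zsum_folded (fun z => lam (- (1) * zpow p z))
    (fun n => 8 * lam ((p ^ 2) ^ n) + - (2) * lam (p ^ n))).
  - intros n Hn. rewrite zpow_nat, zpow_opp_nat.
    assert (Hpn := Cpow_nz p n Hp0).
    assert (H1 : p ^ n <> 1) by (apply Cpow_neq_1; [exact Hp|lia]).
    assert (H2 : - p ^ n <> 1).
    { replace (- p ^ n) with (- (1) * p ^ n) by ring.
      apply Cmod_unit_pow_neq_1; [rewrite Cmod_opp; apply Cmod_1|exact Hp|exact Hn]. }
    replace (- (1) * / p ^ n) with (/ (- p ^ n)).
    + rewrite lam_inv.
      * replace (- (1) * p ^ n) with (- p ^ n) by ring.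
        replace ((p ^ 2) ^ n) with ((p ^ n) ^ 2)
          by (rewrite <- !Cpow_mult_r; f_equal; lia).
        replace (lam (- p ^ n)) with (4 * lam ((p ^ n) ^ 2) - lam (p ^ n))
          by (rewrite <- lam_double by assumption; ring). ring.
      * intros E. apply Hpn. replace (p ^ n) with (- - p ^ n) by ring. rewrite E. ring.
      * exact H2.
    + field. exact Hpn.
  - apply psum_lin_tends; apply lambert_tends; [apply (Cmod_pow_lt_1 p 1 Hp)|exact Hp].
Qed.

Lemma cube_root_facts (w : C) : w ^ 2 + w + 1 = 0 ->
  w ^ 3 = 1 /\ w <> 0 /\ w <> 1 /\ Cmod w = 1%R.
Proof.
  intros Hw.
  assert (H3 : w ^ 3 = 1).
  { replace (w ^ 3) with (1 + (w - 1) * (w ^ 2 + w + 1)) by ring. rewrite Hw. ring. }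
  split; [exact H3|]. split; [|split].
  - intros E. rewrite E in H3. apply C1_nz. rewrite <- H3. ring.
  - intros E. rewrite E in Hw. injection Hw. intros. simpl in *. lra.
  - apply (f_equal Cmod) in H3. rewrite Cmod_pow, Cmod_1 in H3.
    pose proof (Cmod_ge_0 w). simpl in H3. nra.
Qed.

(** The terms of index [n] and [-n] are the values of [lam] at the two primitive cube roots of
    unity times [p^n]; [lam_triple] rewrites their sum. *)
Lemma lam_sum_cube_root (p w : C) : p <> 0 -> (Cmod p < 1)%R -> w ^ 2 + w + 1 = 0 ->
  is_zsum (fun z => lam (w * zpow p z)) (- (1 / 3) + (9 * lambert (p ^ 3) + - (1) * lambert p)).
Proof.
  intros Hp0 Hp Hw. destruct (cube_root_facts w Hw) as [Hw3 [Hw0 [Hw1 Hwm]]].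
  assert (Hw2m : Cmod (w ^ 2) = 1%R) by (rewrite Cmod_pow, Hwm; ring).
  assert (E0 : lam (w * zpow p 0) = - (1 / 3)).
  { unfold lam. change (zpow p 0) with (RtoC 1). rewrite Cmult_1_r.
    replace ((1 - w) ^ 2) with (- (3) * w + (w ^ 2 + w + 1)) by ring.
    rewrite Hw, Cplus_0_r. field. exact Hw0. }
  rewrite <- E0.
  apply (is_zsum_folded (fun z => lam (w * zpow p z))
    (fun n => 9 * lam ((p ^ 3) ^ n) + - (1) * lam (p ^ n))).
  - intros n Hn. rewrite zpow_nat, zpow_opp_nat.
    assert (Hpn := Cpow_nz p n Hp0).
    assert (H1 : p ^ n <> 1) by (apply Cpow_neq_1; [exact Hp|lia]).
    assert (H2 := Cmod_unit_pow_neq_1 w p n Hwm Hp Hn).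
    assert (H3 := Cmod_unit_pow_neq_1 (w ^ 2) p n Hw2m Hp Hn).
    replace (w * / p ^ n) with (/ (w ^ 2 * p ^ n)).
    + rewrite lam_inv; [|apply Cmult_neq_0; [apply Cpow_nz, Hw0|exact Hpn]|exact H3].
      replace ((p ^ 3) ^ n) with ((p ^ n) ^ 3) by (rewrite <- !Cpow_mult_r; f_equal; lia).
      rewrite (Cmult_comm w), (Cmult_comm (w ^ 2)) in *.
      rewrite <- (lam_triple (p ^ n) w) by assumption. ring.
    + apply (Cmult_cancel_r (w ^ 2 * p ^ n)).
      { apply Cmult_neq_0; [apply Cpow_nz, Hw0|exact Hpn]. }
      rewrite Cinv_l by (apply Cmult_neq_0; [apply Cpow_nz, Hw0|exact Hpn]).
      rewrite <- Hw3. field. exact Hpn.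
  - apply psum_lin_tends; apply lambert_tends; [apply (Cmod_pow_lt_1 p 2 Hp)|exact Hp].
Qed.

Lemma half_annulus (q : C) : q <> 0 -> (Cmod q < 1)%R -> annulus (q ^ 2) q.
Proof.
  intros Hq0 Hq. assert (H := proj1 (Cmod_gt_0 q) Hq0).
  split; [|exact Hq]. rewrite Cmod_pow. simpl. nra.
Qed.

(** Adding the bilateral sum at [q] and applying [lam_double] gives four times the bilateral sum
    at [q^2] for the squared base. *)
Lemma lam_sum_minus_half (q : C) : q <> 0 -> (Cmod q < 1)%R ->
  is_zsum (fun z => lam (- q * zpow (q ^ 2) z)) (8 * lambert_odd (q ^ 2) - 2 * lambert_odd q).
Proof.
  intros Hq0 Hq. assert (Hq2 := Cmod_pow_lt_1 q 1 Hq). assert (Hq20 := Cpow_nz q 2 Hq0).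
  assert (Ha := half_annulus q Hq0 Hq).
  assert (Ha' : annulus (q ^ 2) (- q)) by (unfold annulus; rewrite Cmod_opp; exact Ha).
  replace (8 * lambert_odd (q ^ 2)) with (4 * (2 * lambert_odd (q ^ 2))) by ring.
  apply is_zsum_ext with
    (fun z => 4 * lam (q ^ 2 * zpow ((q ^ 2) ^ 2) z) - lam (q * zpow (q ^ 2) z)).
  - intros z.
    assert (H1 := annulus_zpow (q ^ 2) q z Hq20 Ha).
    assert (H2 := annulus_zpow (q ^ 2) (- q) z Hq20 Ha').
    replace (- q * zpow (q ^ 2) z) with (- (q * zpow (q ^ 2) z)) in * by ring.
    replace (q ^ 2 * zpow ((q ^ 2) ^ 2) z) with ((q * zpow (q ^ 2) z) ^ 2).
    + rewrite <- lam_double by assumption. ring.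
    + replace ((q ^ 2) ^ 2) with (q ^ 2 * q ^ 2) by ring.
      rewrite zpow_mult_l by assumption. ring.
  - apply is_zsum_minus; [apply is_zsum_scal|]; apply lam_sum_half; assumption.
Qed.

(** The points [p^(3z+1)] are, up to inversion, the powers of [p] of exponent prime to 3. *)
Lemma lam_sum_third (p : C) : p <> 0 -> (Cmod p < 1)%R ->
  is_zsum (fun z => lam (p * zpow (p ^ 3) z)) (lambert p - lambert (p ^ 3)).
Proof.
  intros Hp0 Hp. assert (Hp3 := Cmod_pow_lt_1 p 2 Hp).
  apply tends_ext with
    (fun N => psum (fun n => lam (p ^ n)) (3 * N + 1) - psum (fun n => lam ((p ^ 3) ^ n)) N).
  - induction n as [|n IH].
    + simpl zsum. simpl psum. rewrite !Cmult_1_r. ring.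
    + rewrite zsum_S, <- IH, zpow_nat, zpow_opp_nat.
      replace (3 * S n + 1)%nat with (S (S (S (3 * n + 1)))) by lia.
      rewrite !psum_S, <- !Cpow_mult_r.
      replace (S (S (3 * n + 1))) with (3 * S n)%nat by lia.
      replace (S (3 * n + 1)) with (3 * n + 2)%nat by lia.
      replace (p * p ^ (3 * S n)) with (p ^ S (3 * S n)) by reflexivity.
      replace (p * / p ^ (3 * S n)) with (/ p ^ (3 * n + 2)).
      * rewrite lam_inv; [ring|apply Cpow_nz, Hp0|apply Cpow_neq_1; [exact Hp|lia]].
      * replace (3 * S n)%nat with (S (3 * n + 2)) by lia. rewrite Cpow_S.
        field. split; (exact Hp0 || apply Cpow_nz, Hp0).
  - apply tends_minus; [|apply lambert_tends, Hp3].
    apply (tends_subseq _ _ (fun N => 3 * N + 1)%nat 0); [intros; lia|apply lambert_tends, Hp].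
Qed.

(** The points [q^(6z+1)] are, up to inversion, the powers of [q] of odd exponent prime to 3. *)
Lemma lam_sum_sixth (q : C) : q <> 0 -> (Cmod q < 1)%R ->
  is_zsum (fun z => lam (q * zpow (q ^ 6) z)) (lambert_odd q - lambert_odd (q ^ 3)).
Proof.
  intros Hq0 Hq. assert (Hq3 := Cmod_pow_lt_1 q 2 Hq).
  apply tends_ext with
    (fun N => psum (fun n => lam (q ^ (2 * n - 1))) (3 * N + 2)
      - psum (fun n => lam ((q ^ 3) ^ (2 * n - 1))) (S N)).
  - induction n as [|n IH].
    + simpl zsum. simpl psum. rewrite !Cmult_1_r. ring.
    + rewrite zsum_S, <- IH, zpow_nat, zpow_opp_nat.
      replace (3 * S n + 2)%nat with (S (S (S (3 * n + 2)))) by lia.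
      rewrite !(psum_S (fun n => lam (q ^ _))), (psum_S _ (S n)), <- !Cpow_mult_r.
      replace (2 * S (S (S (3 * n + 2))) - 1)%nat with (3 * (2 * S (S n) - 1))%nat by lia.
      replace (2 * S (S (3 * n + 2)) - 1)%nat with (S (6 * S n)) by lia.
      replace (2 * S (3 * n + 2) - 1)%nat with (6 * n + 5)%nat by lia.
      replace (q * q ^ (6 * S n)) with (q ^ S (6 * S n)) by reflexivity.
      replace (q * / q ^ (6 * S n)) with (/ q ^ (6 * n + 5)).
      * rewrite lam_inv; [ring|apply Cpow_nz, Hq0|apply Cpow_neq_1; [exact Hq|lia]].
      * replace (6 * S n)%nat with (S (6 * n + 5)) by lia. rewrite Cpow_S.
        field. split; (exact Hq0 || apply Cpow_nz, Hq0).
  - apply tends_minus.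
    + apply (tends_subseq _ _ (fun N => 3 * N + 2)%nat 0); [intros; lia|apply lambert_odd_tends, Hq].
    + apply (tends_subseq _ _ S 0); [intros; lia|apply lambert_odd_tends, Hq3].
Qed.

(** * Theta quotients *)

Lemma qpoch_inf_small_nz (a q : C) :
  (Cmod q < 1)%R -> (Cmod a < 1)%R -> qpoch_inf a q <> 0.
Proof.
  intros Hq Ha. apply qpoch_inf_nz; [exact Hq|]. intros k E.
  apply (f_equal Cmod) in E. rewrite Cmod_mult, Cmod_1 in E.
  assert (H := Cmod_pow_le1 q k Hq). pose proof (Cmod_ge_0 (q ^ k)).
  pose proof (Cmod_ge_0 a). nra.
Qed.

Lemma psi_nz (q : C) : (Cmod q < 1)%R -> psi q <> 0.
Proof.
  intros Hq. assert (Hq2 := Cmod_pow_lt_1 q 1 Hq).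
  apply Cdiv_neq_0; apply qpoch_inf_small_nz; assumption.
Qed.

(** In terms of the four products [(q;q^2)], [(-q;q^2)], [(q^2;q^2)] and [(-q^2;q^2)], which are
    also those of the theta values at the points of order two. *)
Lemma psi_square (q : C) : (Cmod q < 1)%R ->
  psi (q ^ 2) = qpoch_inf (q ^ 2) (q ^ 2) * qpoch_inf (- q ^ 2) (q ^ 2)
    / (qpoch_inf q (q ^ 2) * qpoch_inf (- q) (q ^ 2)).
Proof.
  intros Hq. assert (Hq2 := Cmod_pow_lt_1 q 1 Hq).
  rewrite !qpoch_inf_square by exact Hq2. reflexivity.
Qed.

Lemma theta_half (q : C) : q <> 0 -> theta (q ^ 2) q = qpoch_inf q (q ^ 2) ^ 2.
Proof.
  intros Hq. unfold theta. replace (q ^ 2 / q) with q by (field; exact Hq). ring.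
Qed.

Lemma theta_minus_half (q : C) : q <> 0 -> theta (q ^ 2) (- q) = qpoch_inf (- q) (q ^ 2) ^ 2.
Proof.
  intros Hq. unfold theta. replace (q ^ 2 / - q) with (- q); [ring|].
  field. exact Hq.
Qed.

Lemma theta_minus_one (p : C) : (Cmod p < 1)%R -> theta p (- (1)) = 2 * qpoch_inf (- p) p ^ 2.
Proof.
  intros Hp. unfold theta. rewrite (qpoch_inf_step (- (1))) by exact Hp.
  replace (- (1) * p) with (- p) by ring. replace (p / - (1)) with (- p) by field. ring.
Qed.

(** The addition formula in base [q^2] between the half period [q] and the point [-1]. *)
Lemma lambert_level_four (q : C) : q <> 0 -> (Cmod q < 1)%R ->
  2 * lambert_odd q + 1 / 4 - 8 * lambert (q ^ 4) + 2 * lambert (q ^ 2)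
  = psi q ^ 8 / (4 * psi (q ^ 2) ^ 4).
Proof.
  intros Hq0 Hq. assert (Hq2 := Cmod_pow_lt_1 q 1 Hq). assert (Hq20 := Cpow_nz q 2 Hq0).
  assert (Hoff : off_lattice (q ^ 2) (- (1))).
  { apply unit_off_lattice; try assumption; [rewrite Cmod_opp; apply Cmod_1|apply m1_neq_1]. }
  assert (E := lam_sum_difference (q ^ 2) q (- (1)) _ _ Hq20 (half_annulus q Hq0 Hq) Hoff
    (lam_sum_half q Hq0 Hq) (lam_sum_minus_one (q ^ 2) Hq20 Hq2)).
  replace ((q ^ 2) ^ 2) with (q ^ 4) in E by ring.
  assert (Hm : - (1) / q <> 0).
  { apply Cdiv_neq_0; [|exact Hq0]. intros E0. injection E0. intros. lra. }
  assert (Et := theta_shift (q ^ 2) (- (1) / q) Hq2 Hq20 Hm).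
  replace (q ^ 2 * (- (1) / q)) with (- q) in Et by (field; exact Hq0).
  assert (Et' : theta (q ^ 2) (- (1) / q) = theta (q ^ 2) (- q) / q).
  { rewrite Et. field. exact Hq0. }
  rewrite Et' in E. replace (q * - (1)) with (- q) in E by ring.
  rewrite theta_half, theta_minus_half, theta_minus_one in E by assumption.
  assert (Ha := qpoch_inf_small_nz q (q ^ 2) Hq2 Hq).
  assert (Hb : qpoch_inf (- q) (q ^ 2) <> 0)
    by (apply qpoch_inf_small_nz; [exact Hq2|rewrite Cmod_opp; exact Hq]).
  assert (Hc := qpoch_inf_small_nz (q ^ 2) (q ^ 2) Hq2 Hq2).
  assert (Hd : qpoch_inf (- q ^ 2) (q ^ 2) <> 0)
    by (apply qpoch_inf_small_nz; [exact Hq2|rewrite Cmod_opp; exact Hq2]).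
  rewrite psi_square by exact Hq. unfold psi.
  match type of E with ?l = _ => transitivity l end; [field|].
  rewrite E. revert Ha Hb Hc Hd.
  generalize (qpoch_inf q (q ^ 2)) (qpoch_inf (- q) (q ^ 2)) (qpoch_inf (q ^ 2) (q ^ 2))
    (qpoch_inf (- q ^ 2) (q ^ 2)). intros. field. repeat split; assumption.
Qed.

(** The addition formula in base [q^2] between the half periods [q] and [-q]. *)
Lemma lambert_level_two (q : C) : q <> 0 -> (Cmod q < 1)%R ->
  4 * lambert_odd q - 8 * lambert_odd (q ^ 2) = 4 * q * psi (q ^ 2) ^ 4.
Proof.
  intros Hq0 Hq. assert (Hq2 := Cmod_pow_lt_1 q 1 Hq). assert (Hq20 := Cpow_nz q 2 Hq0).
  assert (Ha' : annulus (q ^ 2) (- q))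
    by (unfold annulus; rewrite Cmod_opp; apply half_annulus; assumption).
  assert (E := lam_sum_difference (q ^ 2) q (- q) _ _ Hq20 (half_annulus q Hq0 Hq)
    (annulus_off_lattice _ _ Hq20 Ha') (lam_sum_half q Hq0 Hq) (lam_sum_minus_half q Hq0 Hq)).
  replace (- q / q) with (- (1)) in E by (field; exact Hq0).
  assert (Em : theta (q ^ 2) (q * - q) = theta (q ^ 2) (- (1))).
  { rewrite <- theta_inv; [f_equal; field; exact Hq0|exact Hq20|].
    intros E0. apply Hq20. replace (q ^ 2) with (- (q * - q)) by ring. rewrite E0. ring. }
  rewrite Em, theta_half, theta_minus_half, theta_minus_one in E by assumption.
  assert (Ha := qpoch_inf_small_nz q (q ^ 2) Hq2 Hq).
  assert (Hb : qpoch_inf (- q) (q ^ 2) <> 0)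
    by (apply qpoch_inf_small_nz; [exact Hq2|rewrite Cmod_opp; exact Hq]).
  rewrite psi_square by exact Hq.
  match type of E with ?l = _ => transitivity l end; [ring|].
  rewrite E. revert Ha Hb.
  generalize (qpoch_inf q (q ^ 2)) (qpoch_inf (- q) (q ^ 2)) (qpoch_inf (q ^ 2) (q ^ 2))
    (qpoch_inf (- q ^ 2) (q ^ 2)). intros. field. repeat split; assumption.
Qed.

Definition omega : C := (- (1 / 2), sqrt 3 / 2)%R.

Lemma omega_eq : omega ^ 2 + omega + 1 = 0.
Proof.
  assert (H := sqrt_sqrt 3 ltac:(lra)).
  unfold omega. apply injective_projections; simpl; [|field].
  replace (sqrt 3 / 2 * (sqrt 3 / 2 * 1 + 0 * 0))%R with (sqrt 3 * sqrt 3 / 4)%R by field.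
  nra.
Qed.

(** The addition formula in base [q^2] between the half period [q] and a point of order three. *)
Lemma lambert_level_six (q : C) : q <> 0 -> (Cmod q < 1)%R ->
  2 * lambert_odd q + 1 / 3 - 9 * lambert (q ^ 6) + lambert (q ^ 2)
  = psi q ^ 6 / (3 * psi (q ^ 3) ^ 2).
Proof.
  intros Hq0 Hq. assert (Hq2 := Cmod_pow_lt_1 q 1 Hq). assert (Hq20 := Cpow_nz q 2 Hq0).
  assert (Hq3 := Cmod_pow_lt_1 q 2 Hq). assert (Hq6 := Cmod_pow_lt_1 q 5 Hq).
  assert (Hw := omega_eq). destruct (cube_root_facts _ Hw) as [Hw3 [Hw0 [Hw1 Hwm]]].
  set (w := omega) in *.
  assert (E := lam_sum_difference (q ^ 2) q w _ _ Hq20 (half_annulus q Hq0 Hq)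
    (unit_off_lattice w _ Hq20 Hq2 Hwm Hw1)
    (lam_sum_half q Hq0 Hq) (lam_sum_cube_root (q ^ 2) w Hq20 Hq2 Hw)).
  assert (Hc := qpoch_inf_small_nz (q ^ 2) (q ^ 2) Hq2 Hq2).
  assert (Ha := qpoch_inf_small_nz q (q ^ 2) Hq2 Hq).
  assert (Ha3 := qpoch_inf_small_nz (q ^ 3) (q ^ 6) Hq6 Hq3).
  assert (Hc3 := qpoch_inf_small_nz (q ^ 6) (q ^ 6) Hq6 Hq6).
  assert (Hw1' := one_minus_nz _ Hw1).
  assert (Ew : theta (q ^ 2) w
    = (1 - w) * qpoch_inf (q ^ 6) (q ^ 6) / qpoch_inf (q ^ 2) (q ^ 2)).
  { assert (H := qpoch_inf_cube (q ^ 2) (q ^ 2) w Hq2 Hw).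
    replace ((q ^ 2) ^ 3) with (q ^ 6) in H by ring. rewrite <- H.
    unfold theta. rewrite (qpoch_inf_step w) by exact Hq2.
    replace (q ^ 2 / w) with (q ^ 2 * w ^ 2)
      by (replace (q ^ 2 / w) with (q ^ 2 * w ^ 3 / w) by (rewrite Hw3; field; exact Hw0);
          field; exact Hw0).
    replace (w * q ^ 2) with (q ^ 2 * w) by ring. field. exact Hc. }
  assert (Eqw : theta (q ^ 2) (q * w) = qpoch_inf (q ^ 3) (q ^ 6) / qpoch_inf q (q ^ 2)).
  { assert (H := qpoch_inf_cube q (q ^ 2) w Hq2 Hw).
    replace ((q ^ 2) ^ 3) with (q ^ 6) in H by ring. rewrite <- H.
    unfold theta.
    replace (q ^ 2 / (q * w)) with (q * w ^ 2)
      by (replace (q ^ 2 / (q * w)) with (q ^ 2 * w ^ 3 / (q * w))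
            by (rewrite Hw3; field; split; assumption);
          field; split; assumption).
    field. exact Ha. }
  assert (Ewq : theta (q ^ 2) (w / q) = - (w / q) * theta (q ^ 2) (q * w)).
  { replace (q * w) with (q ^ 2 * (w / q)) by (field; exact Hq0).
    rewrite theta_shift; [field; split; assumption|exact Hq2|exact Hq20|].
    apply Cdiv_neq_0; assumption. }
  rewrite Ewq, Eqw, Ew, theta_half in E by assumption.
  unfold psi. replace ((q ^ 3) ^ 2) with (q ^ 6) by ring.
  replace ((q ^ 2) ^ 3) with (q ^ 6) in E by ring.
  match type of E with ?l = _ => transitivity l end; [field|].
  rewrite E.
  assert (Ew2 : (1 - w) ^ 2 = - (3) * w).
  { replace ((1 - w) ^ 2) with ((w ^ 2 + w + 1) - 3 * w) by ring. rewrite Hw. ring. }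
  revert Ha Hc Ha3 Hc3.
  generalize (qpoch_inf q (q ^ 2)) (qpoch_inf (q ^ 2) (q ^ 2)) (qpoch_inf (q ^ 3) (q ^ 6))
    (qpoch_inf (q ^ 6) (q ^ 6)). intros a c a3 c3 Ha Hc Ha3 Hc3.
  replace (((1 - w) * c3 / c) ^ 2) with (- (3) * w * c3 ^ 2 / c ^ 2)
    by (rewrite <- Ew2; field; exact Hc).
  field. repeat split; assumption.
Qed.

(** The factors of [(q;q^2)] are sorted by their exponents modulo 6. *)
Lemma theta_sixth_1 (q : C) : q <> 0 -> (Cmod q < 1)%R ->
  theta (q ^ 6) q = qpoch_inf q (q ^ 2) / qpoch_inf (q ^ 3) (q ^ 6).
Proof.
  intros Hq0 Hq. assert (Hq2 := Cmod_pow_lt_1 q 1 Hq).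
  assert (Hq3 := Cmod_pow_lt_1 q 2 Hq). assert (Hq6 := Cmod_pow_lt_1 q 5 Hq).
  assert (Ha3 := qpoch_inf_small_nz (q ^ 3) (q ^ 6) Hq6 Hq3).
  rewrite (qpoch_inf_mod3 q (q ^ 2) Hq2). unfold theta.
  replace ((q ^ 2) ^ 3) with (q ^ 6) by ring. replace (q * q ^ 2) with (q ^ 3) by ring.
  replace (q * (q ^ 2) ^ 2) with (q ^ 5) by ring.
  replace (q ^ 6 / q) with (q ^ 5) by (field; exact Hq0). field. exact Ha3.
Qed.

Lemma theta_sixth_2 (q : C) : q <> 0 -> (Cmod q < 1)%R ->
  theta (q ^ 6) (q ^ 2) = qpoch_inf (q ^ 2) (q ^ 2) / qpoch_inf (q ^ 6) (q ^ 6).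
Proof.
  intros Hq0 Hq. assert (Hq2 := Cmod_pow_lt_1 q 1 Hq).
  assert (Hq6 := Cmod_pow_lt_1 q 5 Hq).
  assert (Hc3 := qpoch_inf_small_nz (q ^ 6) (q ^ 6) Hq6 Hq6).
  rewrite (qpoch_inf_mod3 (q ^ 2) (q ^ 2) Hq2). unfold theta.
  replace ((q ^ 2) ^ 3) with (q ^ 6) by ring. replace (q ^ 2 * q ^ 2) with (q ^ 4) by ring.
  replace (q ^ 2 * (q ^ 2) ^ 2) with (q ^ 6) by ring.
  replace (q ^ 6 / q ^ 2) with (q ^ 4) by (field; exact Hq0). field. exact Hc3.
Qed.

Lemma theta_sixth_3 (q : C) : q <> 0 ->
  theta (q ^ 6) (q ^ 3) = qpoch_inf (q ^ 3) (q ^ 6) ^ 2.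
Proof.
  intros Hq0. replace (q ^ 6) with ((q ^ 3) ^ 2) by ring. apply theta_half, Cpow_nz, Hq0.
Qed.

Lemma sixth_annulus (q : C) (k : nat) : q <> 0 -> (Cmod q < 1)%R -> (1 <= k <= 5)%nat ->
  annulus (q ^ 6) (q ^ k).
Proof.
  intros Hq0 Hq Hk. assert (H := proj1 (Cmod_gt_0 q) Hq0). split.
  - replace 6%nat with (k + S (5 - k))%nat by lia. rewrite Cpow_add_r, Cmod_mult.
    assert (H1 := Cmod_pow_lt_1 q (5 - k) Hq).
    assert (H2 := proj1 (Cmod_gt_0 _) (Cpow_nz q k Hq0)). nra.
  - destruct k as [|k]; [lia|]. apply Cmod_pow_lt_1, Hq.
Qed.

Lemma lam_sum_sixth_3 (q : C) : q <> 0 -> (Cmod q < 1)%R ->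
  is_zsum (fun z => lam (q ^ 3 * zpow (q ^ 6) z)) (2 * lambert_odd (q ^ 3)).
Proof.
  intros Hq0 Hq. replace (q ^ 6) with ((q ^ 3) ^ 2) by ring.
  apply lam_sum_half; [apply Cpow_nz, Hq0|apply (Cmod_pow_lt_1 q 2 Hq)].
Qed.

(** The addition formula in base [q^6] between [q] and the half period [q^3]. *)
Lemma lambert_odd_cubic (q : C) : q <> 0 -> (Cmod q < 1)%R ->
  lambert_odd q - 3 * lambert_odd (q ^ 3) = q * psi q ^ 2 * psi (q ^ 3) ^ 2.
Proof.
  intros Hq0 Hq. assert (Hq2 := Cmod_pow_lt_1 q 1 Hq).
  assert (Hq3 := Cmod_pow_lt_1 q 2 Hq). assert (Hq6 := Cmod_pow_lt_1 q 5 Hq).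
  assert (Hq60 := Cpow_nz q 6 Hq0).
  assert (H1 := sixth_annulus q 1 Hq0 Hq ltac:(lia)). rewrite Cpow_1_r in H1.
  assert (H3 := sixth_annulus q 3 Hq0 Hq ltac:(lia)).
  assert (E := lam_sum_difference (q ^ 6) q (q ^ 3) _ _ Hq60 H1 (annulus_off_lattice _ _ Hq60 H3)
    (lam_sum_sixth q Hq0 Hq) (lam_sum_sixth_3 q Hq0 Hq)).
  replace (q ^ 3 / q) with (q ^ 2) in E by (field; exact Hq0).
  replace (q * q ^ 3) with (q ^ 6 / q ^ 2) in E by (field; exact Hq0).
  rewrite theta_inv, theta_sixth_1, theta_sixth_2, theta_sixth_3 in E
    by (try apply Cpow_nz; assumption).
  assert (Hc := qpoch_inf_small_nz (q ^ 2) (q ^ 2) Hq2 Hq2).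
  assert (Ha := qpoch_inf_small_nz q (q ^ 2) Hq2 Hq).
  assert (Ha3 := qpoch_inf_small_nz (q ^ 3) (q ^ 6) Hq6 Hq3).
  assert (Hc3 := qpoch_inf_small_nz (q ^ 6) (q ^ 6) Hq6 Hq6).
  unfold psi. replace ((q ^ 3) ^ 2) with (q ^ 6) by ring.
  match type of E with ?l = _ => transitivity l end; [ring|].
  rewrite E. revert Ha Hc Ha3 Hc3.
  generalize (qpoch_inf q (q ^ 2)) (qpoch_inf (q ^ 2) (q ^ 2)) (qpoch_inf (q ^ 3) (q ^ 6))
    (qpoch_inf (q ^ 6) (q ^ 6)). intros. field. repeat split; assumption.
Qed.

(** The addition formula in base [q^6] between the third period [q^2] and the half period
    [q^3]. *)
Lemma lambert_cubic (q : C) : q <> 0 -> (Cmod q < 1)%R ->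
  lambert (q ^ 2) - lambert (q ^ 6) - 2 * lambert_odd (q ^ 3)
  = q ^ 2 * psi (q ^ 3) ^ 6 / psi q ^ 2.
Proof.
  intros Hq0 Hq. assert (Hq2 := Cmod_pow_lt_1 q 1 Hq). assert (Hq20 := Cpow_nz q 2 Hq0).
  assert (Hq3 := Cmod_pow_lt_1 q 2 Hq). assert (Hq6 := Cmod_pow_lt_1 q 5 Hq).
  assert (Hq60 := Cpow_nz q 6 Hq0).
  assert (H2 := sixth_annulus q 2 Hq0 Hq ltac:(lia)).
  assert (H3 := sixth_annulus q 3 Hq0 Hq ltac:(lia)).
  assert (E6 := lam_sum_third (q ^ 2) Hq20 Hq2).
  replace ((q ^ 2) ^ 3) with (q ^ 6) in E6 by ring.
  assert (E := lam_sum_difference (q ^ 6) (q ^ 2) (q ^ 3) _ _ Hq60 H2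
    (annulus_off_lattice _ _ Hq60 H3) E6 (lam_sum_sixth_3 q Hq0 Hq)).
  replace (q ^ 3 / q ^ 2) with q in E by (field; exact Hq0).
  replace (q ^ 2 * q ^ 3) with (q ^ 6 / q) in E by (field; exact Hq0).
  rewrite theta_inv, theta_sixth_1, theta_sixth_2, theta_sixth_3 in E by assumption.
  assert (Hc := qpoch_inf_small_nz (q ^ 2) (q ^ 2) Hq2 Hq2).
  assert (Ha := qpoch_inf_small_nz q (q ^ 2) Hq2 Hq).
  assert (Ha3 := qpoch_inf_small_nz (q ^ 3) (q ^ 6) Hq6 Hq3).
  assert (Hc3 := qpoch_inf_small_nz (q ^ 6) (q ^ 6) Hq6 Hq6).
  unfold psi. replace ((q ^ 3) ^ 2) with (q ^ 6) by ring.
  rewrite E. revert Ha Hc Ha3 Hc3.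
  generalize (qpoch_inf q (q ^ 2)) (qpoch_inf (q ^ 2) (q ^ 2)) (qpoch_inf (q ^ 3) (q ^ 6))
    (qpoch_inf (q ^ 6) (q ^ 6)). intros. field. repeat split; assumption.
Qed.

(** * The second derivative at the half period *)

(** As [s] is a partial sum of a geometric series, both bounds are uniform in [n], so that the
    estimate passes to the infinite product. *)
Lemma qpoch_lipschitz (q a b : C) (B : R) (n : nat) :
  (Cmod q < 1)%R -> (Cmod a <= B)%R -> (Cmod b <= B)%R ->
  let s := ((1 - Cmod q ^ n) / (1 - Cmod q))%R in
  (Cmod (qpoch b q n) <= exp (B * s))%R /\
  (Cmod (qpoch a q n - qpoch b q n) <= Cmod (a - b) * (s * exp (B * s)))%R.
Proof.
  intros Hq Ha Hb. assert (H0 := Cmod_ge_0 q).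
  assert (HB : (0 <= B)%R) by (pose proof (Cmod_ge_0 a); lra).
  assert (Hfac : forall c k, (Cmod c <= B)%R -> (Cmod (1 - c * q ^ k) <= exp (B * Cmod q ^ k))%R).
  { intros c k Hc. eapply Rle_trans; [apply Cmod_minus_triangle|].
    rewrite Cmod_1, Cmod_mult, Cmod_pow.
    apply Rle_trans with (1 + B * Cmod q ^ k)%R; [|apply exp_ineq1_le].
    apply Rplus_le_compat_l, Rmult_le_compat_r; [apply pow_le; lra|exact Hc]. }
  induction n as [|n [IH1 IH2]]; cbv zeta.
  - simpl. replace ((1 - 1) / (1 - Cmod q))%R with 0%R by (field; lra).
    rewrite Rmult_0_r, exp_0, Cmod_1. replace (1 - 1) with (RtoC 0) by ring. rewrite Cmod_0. lra.
  - set (r := Cmod q) in *. cbv zeta in IH1, IH2.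
    assert (Es : ((1 - r ^ S n) / (1 - r) = (1 - r ^ n) / (1 - r) + r ^ n)%R)
      by (simpl; field; lra).
    rewrite Es, Rmult_plus_distr_l, exp_plus.
    set (s := ((1 - r ^ n) / (1 - r))%R) in *.
    assert (Hrn : (0 <= r ^ n)%R) by (apply pow_le; exact H0).
    assert (He := exp_pos (B * s)). assert (He' := exp_pos (B * r ^ n)).
    assert (H1e : (1 <= exp (B * r ^ n))%R).
    { rewrite <- exp_0. assert (Hp : (0 <= B * r ^ n)%R) by (apply Rmult_le_pos; assumption).
      destruct Hp as [Hp|Hp]; [left; apply exp_increasing, Hp|right; rewrite <- Hp; reflexivity]. }
    rewrite !qpoch_S. split.
    + rewrite Cmod_mult. apply Rmult_le_compat; try apply Cmod_ge_0; [exact IH1|apply Hfac, Hb].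
    + replace (qpoch a q n * (1 - a * q ^ n) - qpoch b q n * (1 - b * q ^ n))
        with ((qpoch a q n - qpoch b q n) * (1 - a * q ^ n) - qpoch b q n * ((a - b) * q ^ n))
        by ring.
      eapply Rle_trans; [apply Cmod_minus_triangle|]. rewrite !Cmod_mult, Cmod_pow. fold r.
      assert (Hd := Cmod_ge_0 (a - b)).
      apply Rle_trans with (Cmod (a - b) * (s * exp (B * s)) * exp (B * r ^ n)
        + exp (B * s) * (Cmod (a - b) * r ^ n))%R.
      * apply Rplus_le_compat.
        -- apply Rmult_le_compat; try apply Cmod_ge_0; [exact IH2|apply Hfac, Ha].
        -- apply Rmult_le_compat_r; [apply Rmult_le_pos; assumption|exact IH1].
      * assert (Hx : (0 <= exp (B * s) * (Cmod (a - b) * r ^ n))%R)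
          by (apply Rmult_le_pos; [lra|apply Rmult_le_pos; assumption]).
        apply Rle_trans with (Cmod (a - b) * (s * exp (B * s)) * exp (B * r ^ n)
          + exp (B * s) * (Cmod (a - b) * r ^ n) * exp (B * r ^ n))%R; [nra|right; ring].
Qed.

Lemma qpoch_inf_continuous (q a : C) (u : nat -> C) :
  (Cmod q < 1)%R -> tends u a -> tends (fun n => qpoch_inf (u n) q) (qpoch_inf a q).
Proof.
  intros Hq Hu. assert (H0 := Cmod_ge_0 q).
  destruct (tends_bounded _ _ Hu) as [B [HB HuB]].
  assert (HaB := tends_Cmod_le _ _ _ Hu HuB).
  set (K := (/ (1 - Cmod q) * exp (B * / (1 - Cmod q)))%R).
  assert (Hinv : (0 < / (1 - Cmod q))%R) by (apply Rinv_0_lt_compat; lra).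
  apply tends_squeeze with (fun n => K * Cmod (u n - a))%R.
  - intros n.
    apply (tends_Cmod_le (fun k => qpoch (u n) q k - qpoch a q k)).
    + apply tends_minus; apply qpoch_tends, Hq.
    + intros k. destruct (qpoch_lipschitz q (u n) a B k Hq (HuB n) HaB) as [_ H].
      eapply Rle_trans; [exact H|]. rewrite (Rmult_comm K).
      apply Rmult_le_compat_l; [apply Cmod_ge_0|].
      assert (Hk : (0 <= Cmod q ^ k)%R) by (apply pow_le; lra).
      assert (Hk' : (Cmod q ^ k <= 1)%R) by (rewrite <- (pow1 k); apply pow_incr; lra).
      set (s := ((1 - Cmod q ^ k) / (1 - Cmod q))%R).
      assert (Hs0 : (0 <= s)%R) by (apply Rmult_le_pos; lra).
      assert (Hs : (s <= / (1 - Cmod q))%R).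
      { unfold s, Rdiv. rewrite <- (Rmult_1_l (/ (1 - Cmod q))) at 2.
        apply Rmult_le_compat_r; lra. }
      apply Rmult_le_compat; [exact Hs0|left; apply exp_pos|exact Hs|].
      assert (Hm : (B * s <= B * / (1 - Cmod q))%R) by (apply Rmult_le_compat_l; lra).
      destruct Hm as [Hm|Hm]; [left; apply exp_increasing, Hm|right; rewrite Hm; reflexivity].
  - apply tends_Cmod in Hu. replace (Finite 0) with (Finite (K * 0)) by (f_equal; ring).
    apply (is_lim_seq_scal_l _ K 0 Hu).
Qed.

(** Dominated convergence for complete sums: the truncation at [N] costs a tail of order
    [r^N]. *)
Lemma tannery_full (M r : R) (f : nat -> Z -> C) (g : Z -> C) (sigma : nat -> C) :
  (0 <= r < 1)%R -> (forall N, decays M r (f N)) ->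
  (forall z, tends (fun N => f N z) (g z)) -> (forall N, is_zsum (f N) (sigma N)) ->
  exists l, is_zsum g l /\ tends sigma l.
Proof.
  intros Hr Hf Hg Hs. destruct (tannery M r f g Hr Hf Hg) as [l [Hl1 Hl2]].
  exists l. split; [exact Hl1|].
  apply tends_ext with (fun N => (sigma N - zsum (f N) N) + zsum (f N) N); [intros; ring|].
  replace l with (0 + l) by ring. apply tends_plus; [|exact Hl2].
  apply tends_squeeze with (fun N => 2 * M / (1 - r) * r ^ N)%R.
  - intros N. replace (sigma N - zsum (f N) N - 0) with (sigma N - zsum (f N) N) by ring.
    apply (tends_Cmod_le (fun k => zsum (f N) (k + N) - zsum (f N) N)).
    + apply tends_minus; [|apply tends_const].
      apply (tends_subseq _ _ (fun k => k + N)%nat 0); [intros; lia|apply Hs].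
    + intros k. apply decays_tail_pow; [exact Hr|apply Hf|lia].
  - replace (Finite 0) with (Finite (2 * M / (1 - r) * 0)) by (f_equal; ring).
    apply (is_lim_seq_scal_l _ (2 * M / (1 - r)) 0). apply is_lim_seq_geom.
    rewrite Rabs_pos_eq; lra.
Qed.

(** Since [1 / lam x = x + 1/x - 2], the second difference of [lam] for the multiplicative step
    [t] is rational in [L = lam x] and in [s = (1 - t)^2 / t]; this is that difference divided by
    [s].  At [s = 0] it is [L + 6 L^2], the second derivative in the logarithmic variable. *)
Definition second_quotient (s L : C) : C := (L + 6 * L ^ 2 - 2 * s * L ^ 3) / (1 - s * L) ^ 2.

Lemma lam_second_difference (x t : C) :
  x <> 1 -> t <> 0 -> x * t <> 1 -> x <> 0 -> x / t <> 1 ->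
  let s := (1 - t) ^ 2 / t in
  lam (x * t) + lam (x / t) - 2 * lam x = s * second_quotient s (lam x).
Proof.
  intros Hx Ht H1 Hx0 H2 s.
  assert (Hx' := one_minus_nz _ Hx). assert (H1' := one_minus_nz _ H1).
  assert (H2' : t - x <> 0).
  { intros E. apply H2. replace x with (t - (t - x)) by ring. rewrite E. field. exact Ht. }
  assert (Es : 1 - s * lam x = (1 - x * t) * (t - x) / (t * (1 - x) ^ 2)).
  { unfold s, lam. field. split; assumption. }
  unfold second_quotient. rewrite Es. unfold s, lam. field. repeat split; assumption.
Qed.

Lemma second_quotient_bound (s L : C) (M : R) :
  (Cmod L <= M)%R -> (Cmod s * M <= / 2)%R ->
  (Cmod (second_quotient s L) <= 4 * (2 + 6 * M + M) * Cmod L)%R.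
Proof.
  intros HL Hs. assert (H0 := Cmod_ge_0 L). assert (Hs0 := Cmod_ge_0 s).
  assert (HsL : (Cmod (s * L) <= / 2)%R) by (rewrite Cmod_mult; nra).
  assert (Hden : (/ 2 <= Cmod (1 - s * L))%R).
  { assert (Ht := Cmod_triangle (1 - s * L) (s * L)).
    replace (1 - s * L + s * L) with (RtoC 1) in Ht by ring. rewrite Cmod_1 in Ht. lra. }
  assert (Hnz : 1 - s * L <> 0).
  { intros E. rewrite E, Cmod_0 in Hden. lra. }
  unfold second_quotient.
  replace (L + 6 * L ^ 2 - 2 * s * L ^ 3) with (L * (1 + 6 * L - 2 * (s * L) * L)) by ring.
  rewrite Cmod_div, Cmod_mult, Cmod_pow by (apply Cpow_nz, Hnz).
  assert (Hnum : (Cmod (1 + 6 * L - 2 * (s * L) * L) <= 2 + 6 * M + M)%R).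
  { eapply Rle_trans; [apply Cmod_minus_triangle|].
    assert (Ha := Cmod_triangle 1 (6 * L)).
    rewrite Cmod_1 in Ha. rewrite !Cmod_mult in *.
    rewrite !Cmod_R, !Rabs_pos_eq in * by lra. nra. }
  set (A := Cmod (1 + 6 * L - 2 * (s * L) * L)) in *. set (D := Cmod (1 - s * L)) in *.
  assert (HA : (0 <= A)%R) by apply Cmod_ge_0.
  assert (HD : (0 < D)%R) by lra.
  apply Rmult_le_reg_r with (D ^ 2)%R; [apply pow_lt, HD|].
  replace (Cmod L * A / D ^ 2 * D ^ 2)%R with (Cmod L * A)%R by (field; lra).
  assert (HD2 : (1 <= 4 * D ^ 2)%R) by (simpl; nra).
  assert (Cmod L * A <= (2 + 6 * M + M) * Cmod L)%R by nra.
  assert (0 <= (2 + 6 * M + M) * Cmod L)%R by (apply Rmult_le_pos; lra).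
  nra.
Qed.

(** The addition formula between [q t] and [q], divided by the double zero at [t = 1]. *)
Definition perturbed_quotient (q t : C) : C :=
  q * (qpoch_inf (q ^ 2 * t) (q ^ 2) * qpoch_inf (q ^ 2 / t) (q ^ 2)) ^ 2
    * qpoch_inf (q ^ 2) (q ^ 2) ^ 4 / (theta (q ^ 2) (q * t) ^ 2 * qpoch_inf q (q ^ 2) ^ 4).
Lemma lam_sum_perturbed (q t Ft F1 : C) : q <> 0 -> (Cmod q < 1)%R ->
  t <> 0 -> annulus (q ^ 2) (q * t) ->
  is_zsum (fun z => lam (q * t * zpow (q ^ 2) z)) Ft ->
  is_zsum (fun z => lam (q * zpow (q ^ 2) z)) F1 ->
  Ft - F1 = (1 - t) ^ 2 / t * perturbed_quotient q t.
Proof.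
  intros Hq0 Hq Ht0 Hqt HFt HF1.
  assert (Hq2 := Cmod_pow_lt_1 q 1 Hq). assert (Hq20 := Cpow_nz q 2 Hq0).
  assert (Ha := half_annulus q Hq0 Hq).
  assert (E := lam_sum_difference (q ^ 2) (q * t) q _ _ Hq20 Hqt
    (annulus_off_lattice _ _ Hq20 Ha) HFt HF1).
  replace (q / (q * t)) with (/ t) in E by (field; split; assumption).
  replace (q * t * q) with (q ^ 2 / (/ t)) in E by (field; exact Ht0).
  assert (Ht0' := Cinv_neq_0 t Ht0).
  rewrite theta_inv, theta_half in E by assumption.
  assert (Ei : theta (q ^ 2) (/ t)
    = (1 - / t) * (qpoch_inf (q ^ 2 * t) (q ^ 2) * qpoch_inf (q ^ 2 / t) (q ^ 2))).
  { unfold theta. rewrite (qpoch_inf_step (/ t)) by exact Hq2.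
    replace (q ^ 2 / / t) with (q ^ 2 * t) by (field; exact Ht0).
    replace (/ t * q ^ 2) with (q ^ 2 / t) by (unfold Cdiv; ring). ring. }
  rewrite Ei in E. rewrite E.
  assert (Hd := theta_nz (q ^ 2) (q * t) Hq20 Hq2 (Cmult_neq_0 _ _ Hq0 Ht0)
    (fun z => annulus_zpow _ _ z Hq20 Hqt)).
  assert (Haq := qpoch_inf_small_nz q (q ^ 2) Hq2 Hq).
  unfold perturbed_quotient. field. repeat split; assumption.
Qed.

Lemma perturbed_quotient_tends (q : C) (u : nat -> C) : q <> 0 -> (Cmod q < 1)%R ->
  (forall n, u n <> 0) -> (forall n, annulus (q ^ 2) (q * u n)) -> tends u 1 ->
  tends (fun n => perturbed_quotient q (u n)) (q * psi q ^ 8).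
Proof.
  intros Hq0 Hq Hu0 Hua Hu.
  assert (Hq2 := Cmod_pow_lt_1 q 1 Hq). assert (Hq20 := Cpow_nz q 2 Hq0).
  assert (Ha := qpoch_inf_small_nz q (q ^ 2) Hq2 Hq).
  assert (Hinv : forall c, tends (fun n => c / u n) c).
  { intros c. assert (H := tends_div _ _ c 1 C1_nz Hu0 (tends_const c) Hu).
    replace (c / 1) with c in H by field. exact H. }
  assert (Hmul : forall c, tends (fun n => c * u n) c).
  { intros c. assert (H := tends_scal c _ _ Hu). rewrite Cmult_1_r in H. exact H. }
  assert (Htheta : tends (fun n => theta (q ^ 2) (q * u n)) (qpoch_inf q (q ^ 2) ^ 2)).
  { replace (qpoch_inf q (q ^ 2) ^ 2) with (qpoch_inf q (q ^ 2) * qpoch_inf q (q ^ 2)) by ring.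
    apply tends_mult; apply qpoch_inf_continuous; try exact Hq2; [apply Hmul|].
    apply tends_ext with (fun n => q / u n); [|apply Hinv].
    intros n. field. split; [apply Hu0|exact Hq0]. }
  replace (q * psi q ^ 8) with
    (q * (qpoch_inf (q ^ 2) (q ^ 2) * qpoch_inf (q ^ 2) (q ^ 2)) ^ 2
      * qpoch_inf (q ^ 2) (q ^ 2) ^ 4 / ((qpoch_inf q (q ^ 2) ^ 2) ^ 2 * qpoch_inf q (q ^ 2) ^ 4))
    by (unfold psi; field; exact Ha).
  apply tends_div.
  - apply Cmult_neq_0; repeat apply Cpow_nz; exact Ha.
  - intros n. apply Cmult_neq_0; [|apply Cpow_nz, Ha]. apply Cpow_nz, theta_nz; try assumption.
    + apply Cmult_neq_0; [exact Hq0|apply Hu0].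
    + intros z. apply annulus_zpow; [exact Hq20|apply Hua].
  - apply tends_mult; [|apply tends_const]. apply tends_scal, tends_pow, tends_mult;
      apply qpoch_inf_continuous; try exact Hq2; [apply Hmul|apply Hinv].
  - apply tends_mult; [apply tends_pow, Htheta|apply tends_const].
Qed.

(** The second difference of the bilateral sum at the half period, divided by the square of the
    step, has two limits as the step tends to zero: term by term through [second_quotient], and
    through [perturbed_quotient] at [t] and [1/t]. *)
Lemma second_derivative_half (q : C) : q <> 0 -> (Cmod q < 1)%R ->
  is_zsum (fun z => lam (q * zpow (q ^ 2) z) + 6 * lam (q * zpow (q ^ 2) z) ^ 2)
    (2 * (q * psi q ^ 8)).
Proof.
  intros Hq0 Hq.
  assert (Hq' := proj1 (Cmod_gt_0 q) Hq0).
  assert (Hq2 := Cmod_pow_lt_1 q 1 Hq). assert (Hq20 := Cpow_nz q 2 Hq0).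
  assert (Ha := half_annulus q Hq0 Hq).
  assert (Hoff := annulus_off_lattice _ _ Hq20 Ha).
  destruct (lam_decays (q ^ 2) q Hq20 Hq2 Hoff) as [M HM].
  assert (HM0 := decays_nonneg _ _ _ HM).
  assert (Hr : (0 <= Cmod (q ^ 2) < 1)%R) by (split; [apply Cmod_ge_0|exact Hq2]).
  set (L := fun z => lam (q * zpow (q ^ 2) z)) in *.
  assert (HL : forall z, (Cmod (L z) <= M)%R).
  { intros z. eapply Rle_trans; [apply HM|]. rewrite <- (Rmult_1_r M) at 2.
    apply Rmult_le_compat_l; [exact HM0|]. rewrite <- (pow1 (Z.abs_nat z)). apply pow_incr. lra. }
  (* The first bound keeps [s L] below one half; the second keeps [q t] in the annulus. *)
  set (delta := Rmin (/ (2 * (M + 1))) ((1 - Cmod q) / 2)).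
  assert (Hd0 : (0 < delta)%R).
  { apply Rmin_glb_lt; [apply Rinv_0_lt_compat; lra|lra]. }
  assert (HdM : (delta * M <= / 2)%R).
  { apply Rle_trans with (/ (2 * (M + 1)) * M)%R.
    - apply Rmult_le_compat_r; [exact HM0|apply Rmin_l].
    - apply Rmult_le_reg_l with (2 * (M + 1))%R; [lra|].
      rewrite <- Rmult_assoc, Rinv_r by lra. lra. }
  assert (Hdq : (delta <= (1 - Cmod q) / 2)%R) by apply Rmin_r.
  set (e := fun N : nat => (delta * (/ 2) ^ N)%R).
  assert (He : forall N, (0 < e N <= delta)%R).
  { intros N. unfold e. assert (H1 : (0 < (/ 2) ^ N)%R) by (apply pow_lt; lra).
    assert (H2 : ((/ 2) ^ N <= 1)%R) by (rewrite <- (pow1 N); apply pow_incr; lra). nra. }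
  set (t := fun N : nat => RtoC (1 + e N)).
  assert (Ht0 : forall N, t N <> 0).
  { intros N E. injection E. specialize (He N). intros. lra. }
  assert (HtC : forall N, Cmod (t N) = (1 + e N)%R).
  { intros N. specialize (He N). unfold t. rewrite Cmod_R. apply Rabs_pos_eq. lra. }
  assert (Ht1 : tends t 1).
  { apply tends_squeeze with e.
    - intros N. specialize (He N). replace (t N - 1) with (RtoC (e N))
        by (unfold t; rewrite RtoC_plus; ring).
      rewrite Cmod_R, Rabs_pos_eq; lra.
    - unfold e. replace (Finite 0) with (Finite (delta * 0)) by (f_equal; ring).
      apply (is_lim_seq_scal_l _ delta 0). apply is_lim_seq_geom. rewrite Rabs_pos_eq; lra. }
  assert (Han : forall N, annulus (q ^ 2) (q * t N)).
  { intros N. specialize (He N). unfold annulus.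
    rewrite Cmod_mult, HtC, Cmod_pow. simpl. split; nra. }
  assert (Han' : forall N, annulus (q ^ 2) (q * / t N)).
  { intros N. replace (q * / t N) with (q ^ 2 / (q * t N))
      by (field; split; [apply Ht0|exact Hq0]).
    apply annulus_inv; [exact Hq20|apply Han]. }
  assert (Hti0 : forall N, / t N <> 0) by (intros N; apply Cinv_neq_0, Ht0).
  assert (Hti1 : tends (fun N => / t N) 1).
  { replace (RtoC 1) with (/ 1) by field. apply tends_inv; [exact C1_nz|exact Ht0|exact Ht1]. }
  set (s := fun N => (1 - t N) ^ 2 / t N).
  assert (Es : forall N, s N = RtoC (e N * e N / (1 + e N))).
  { intros N. unfold s. replace (1 - t N) with (- RtoC (e N))
      by (unfold t; rewrite RtoC_plus; ring).
    specialize (He N). unfold t. rewrite RtoC_div by lra. rewrite RtoC_mult. unfold Cdiv. ring. }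
  assert (HsM : forall N, (Cmod (s N) * M <= / 2)%R).
  { intros N. rewrite Es, Cmod_R. specialize (He N).
    assert (Hs1 : (0 <= e N * e N / (1 + e N) <= delta)%R).
    { split; [apply Rmult_le_pos; [nra|left; apply Rinv_0_lt_compat; lra]|].
      apply Rmult_le_reg_r with (1 + e N)%R; [lra|].
      unfold Rdiv. rewrite Rmult_assoc, Rinv_l by lra. nra. }
    rewrite Rabs_pos_eq by lra. nra. }
  assert (Hs0 : forall N, s N <> 0).
  { intros N. rewrite Es. intros E. injection E. intros E'. specialize (He N).
    apply (Rmult_integral_contrapositive_currified (e N * e N) (/ (1 + e N)));
      [nra|apply Rinv_neq_0_compat; lra|exact E']. }
  assert (Hslim : tends s 0).
  { replace (RtoC 0) with ((1 - 1) ^ 2 / 1) by field.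
    apply tends_div; [exact C1_nz|exact Ht0| |exact Ht1].
    apply tends_pow, tends_minus; [apply tends_const|exact Ht1]. }
  destruct (tannery_full (4 * (2 + 6 * M + M) * M) (Cmod (q ^ 2))
    (fun N z => second_quotient (s N) (L z)) (fun z => L z + 6 * L z ^ 2)
    (fun N => perturbed_quotient q (t N) + perturbed_quotient q (/ t N)) Hr) as [l [Hl1 Hl2]].
  - intros N z. eapply Rle_trans; [apply (second_quotient_bound _ _ M); [apply HL|apply HsM]|].
    rewrite (Rmult_assoc (4 * (2 + 6 * M + M)) M).
    apply Rmult_le_compat_l; [lra|apply HM].
  - intros z. unfold second_quotient.
    cut (forall l, l = (L z + 6 * L z ^ 2 - 2 * 0 * L z ^ 3) / (1 - 0 * L z) ^ 2 ->
      tends (fun N => (L z + 6 * L z ^ 2 - 2 * s N * L z ^ 3) / (1 - s N * L z) ^ 2) l).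
    { intros H. apply H. field. }
    intros l ->. apply tends_div.
    + apply Cpow_nz. replace (1 - 0 * L z) with (RtoC 1) by ring. exact C1_nz.
    + intros N. apply Cpow_nz. intros E.
      assert (Hsm : (Cmod (s N * L z) <= / 2)%R).
      { rewrite Cmod_mult. eapply Rle_trans; [|apply (HsM N)].
        apply Rmult_le_compat_l; [apply Cmod_ge_0|apply HL]. }
      replace (s N * L z) with (1 - (1 - s N * L z)) in Hsm by ring.
      rewrite E in Hsm. replace (1 - 0) with (RtoC 1) in Hsm by ring.
      rewrite Cmod_1 in Hsm. lra.
    + apply tends_minus; [apply tends_const|].
      apply tends_mult; [apply tends_scal, Hslim|apply tends_const].
    + apply tends_pow, tends_minus; [apply tends_const|].
      apply tends_mult; [exact Hslim|apply tends_const].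
  - intros N.
    destruct (lam_cvg _ _ Hq20 Hq2 (annulus_off_lattice _ _ Hq20 (Han N))) as [F1 HF1].
    destruct (lam_cvg _ _ Hq20 Hq2 (annulus_off_lattice _ _ Hq20 (Han' N))) as [F2 HF2].
    destruct (lam_cvg _ _ Hq20 Hq2 Hoff) as [F0 HF0].
    assert (E1 := lam_sum_perturbed q (t N) F1 F0 Hq0 Hq (Ht0 N) (Han N) HF1 HF0).
    assert (E2 := lam_sum_perturbed q (/ t N) F2 F0 Hq0 Hq (Hti0 N) (Han' N) HF2 HF0).
    replace ((1 - / t N) ^ 2 / / t N) with (s N) in E2 by (unfold s; field; apply Ht0).
    fold (s N) in E1.
    replace (perturbed_quotient q (t N) + perturbed_quotient q (/ t N))
      with (/ s N * ((F1 + F2) - 2 * F0)).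
    + apply is_zsum_ext with (fun z => / s N *
        ((lam (q * t N * zpow (q ^ 2) z) + lam (q * / t N * zpow (q ^ 2) z))
          - 2 * lam (q * zpow (q ^ 2) z))).
      * intros z. set (x := q * zpow (q ^ 2) z).
        assert (Hx0 : x <> 0) by (apply Cmult_neq_0; [exact Hq0|apply zpow_nz, Hq20]).
        assert (H1 := annulus_zpow _ _ z Hq20 (Han N)).
        assert (H2 := annulus_zpow _ _ z Hq20 (Han' N)).
        replace (q * t N * zpow (q ^ 2) z) with (x * t N) in * by (unfold x; ring).
        replace (q * / t N * zpow (q ^ 2) z) with (x / t N) in * by (unfold x, Cdiv; ring).
        rewrite (lam_second_difference x (t N) (proj2 Hoff z) (Ht0 N) H1 Hx0 H2).
        fold (s N). unfold L. fold x. field. apply Hs0.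
      * apply is_zsum_scal, is_zsum_minus; [apply is_zsum_plus; assumption|].
        apply is_zsum_scal, HF0.
    + replace (F1 + F2 - 2 * F0) with ((F1 - F0) + (F2 - F0)) by ring.
      rewrite E1, E2. field. apply Hs0.
  - replace (2 * (q * psi q ^ 8)) with l; [exact Hl1|].
    apply (tends_unique _ _ _ Hl2). replace (2 * (q * psi q ^ 8))
      with (q * psi q ^ 8 + q * psi q ^ 8) by ring.
    apply tends_plus; apply perturbed_quotient_tends; assumption.
Qed.

Lemma lambert_odd_fourth (q : C) : q <> 0 -> (Cmod q < 1)%R ->
  6 * Csum1 (fun n => q ^ (4 * n - 2) / (1 - q ^ (2 * n - 1)) ^ 4) + lambert_odd q
  = q * psi q ^ 8.
Proof.
  intros Hq0 Hq.
  assert (H4 : tends (psum (fun n => q ^ (4 * n - 2) / (1 - q ^ (2 * n - 1)) ^ 4))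
    (Csum1 (fun n => q ^ (4 * n - 2) / (1 - q ^ (2 * n - 1)) ^ 4))).
  { apply psum_tends.
    apply (ex_series_lambert q (fun n => 2 * S n - 1)%nat (fun n => 4 * S n - 2)%nat 4 Hq);
      intros; lia. }
  assert (H := psum_lin_tends 6 1 _ _ _ _ H4 (lambert_odd_tends q Hq)).
  assert (Eu : forall n x, x = q ^ (2 * S n - 1) ->
    lam x + 6 * lam x ^ 2
    = 6 * (q ^ (4 * S n - 2) / (1 - q ^ (2 * S n - 1)) ^ 4) + 1 * lam (q ^ (2 * S n - 1))).
  { intros n x ->.
    replace (4 * S n - 2)%nat with ((2 * S n - 1) * 2)%nat by lia.
    rewrite Cpow_mult_r.
    assert (Hx : 1 - q ^ (2 * S n - 1) <> 0)
      by (apply one_minus_nz, Cpow_neq_1; [exact Hq|lia]).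
    unfold lam. field. exact Hx. }
  assert (Hz : is_zsum (fun z => lam (q * zpow (q ^ 2) z) + 6 * lam (q * zpow (q ^ 2) z) ^ 2)
    (2 * (6 * Csum1 (fun n => q ^ (4 * n - 2) / (1 - q ^ (2 * n - 1)) ^ 4) + 1 * lambert_odd q))).
  { apply is_zsum_doubled with (3 := H).
    - intros n. apply Eu, lam_odd_pos.
    - intros n. rewrite (lam_odd_neg q n Hq0 Hq). apply Eu. reflexivity. }
  assert (E := tends_unique _ _ _ Hz (second_derivative_half q Hq0 Hq)).
  apply (Cmult_cancel_r 2); [intros E0; injection E0; intros; lra|].
  rewrite (Cmult_comm (q * psi q ^ 8)), <- E. ring.
Qed.

(** * The identities *)

Lemma cexp_plus (u v : C) : cexp (u + v) = cexp u * cexp v.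
Proof.
  destruct u as [a b], v as [c d]. unfold cexp. simpl.
  rewrite exp_plus, cos_plus, sin_plus. apply injective_projections; simpl; ring.
Qed.

Lemma cexp_nz (z : C) : cexp z <> 0.
Proof.
  intros E. assert (H := cexp_plus z (- z)). rewrite E in H.
  replace (z + - z) with (RtoC 0) in H by ring.
  unfold cexp in H. simpl in H. rewrite exp_0, cos_0, sin_0 in H.
  injection H. intros. lra.
Qed.

(** The fractional powers are all powers of one fourth root of the nome, the one chosen by
    [tau]. *)
Lemma qpow_quarter (tau : C) (k : nat) : qpow tau (INR k / 4) = qpow tau (1 / 4) ^ k.
Proof.
  induction k as [|k IH].
  - unfold qpow. replace (PI * Ci * tau * (INR 0 / 4)%R) with (RtoC 0).
    + unfold cexp. simpl. rewrite exp_0, cos_0, sin_0.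
      apply injective_projections; simpl; ring.
    + simpl INR. replace (0 / 4)%R with 0%R by field. ring.
  - rewrite Cpow_S, <- IH. unfold qpow. rewrite <- cexp_plus. f_equal.
    rewrite S_INR. replace ((INR k + 1) / 4)%R with (1 / 4 + INR k / 4)%R by field.
    rewrite RtoC_plus. ring.
Qed.

Lemma nome_quarter (tau : C) : nome tau = qpow tau (1 / 4) ^ 4.
Proof.
  rewrite <- qpow_quarter. unfold nome, qpow. f_equal.
  replace (INR 4 / 4)%R with 1%R by (simpl; field). ring.
Qed.

Theorem theorem1 (tau : C) (Htau : (0 < Im tau)%R) :
  let q := nome tau in
  let P := GosperPi tau in
  (* (a) *)
  Csum1 (fun n => q ^ n / (1 - q ^ n) ^ 2)
    - 2 * Csum1 (fun n => q ^ (2 * n) / (1 - q ^ (2 * n)) ^ 2)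
  = 1 / 24 * (P 1%nat ^ 4 / P 2%nat ^ 2 - 1) + 2 / 3 * P 2%nat ^ 2
  /\
  (* (b) *)
  Csum1 (fun n => q ^ n / (1 - q ^ n) ^ 2)
    - 3 * Csum1 (fun n => q ^ (3 * n) / (1 - q ^ (3 * n)) ^ 2)
  = (P 1%nat ^ 2 + 3 * P 3%nat ^ 2) ^ 2 / (12 * P 1%nat * P 3%nat) - 1 / 12
  /\
  (* (c) *)
  Csum1 (fun n => q ^ n / (1 - q ^ n) ^ 2)
    - 4 * Csum1 (fun n => q ^ (4 * n) / (1 - q ^ (4 * n)) ^ 2)
  = 1 / 8 * (P 1%nat ^ 4 / P 2%nat ^ 2 - 1)
  /\
  (* (d) *)
  Csum1 (fun n => q ^ (2 * n) / (1 - q ^ (2 * n)) ^ 2)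
    - 9 * Csum1 (fun n => q ^ (18 * n) / (1 - q ^ (18 * n)) ^ 2)
  = P 3%nat ^ 3 / P 1%nat + 1 / 3 * (P 3%nat ^ 3 / P 9%nat - 1)
  /\
  (* (e) *)
  Csum1 (fun n => q ^ (2 * n - 1) / (1 - q ^ (2 * n - 1)) ^ 2)
    - 3 * Csum1 (fun n => q ^ (6 * n - 3) / (1 - q ^ (6 * n - 3)) ^ 2)
  = P 3%nat * P 1%nat
  /\
  (* (f) *)
  6 * Csum1 (fun n => q ^ (4 * n - 2) / (1 - q ^ (2 * n - 1)) ^ 4)
    + Csum1 (fun n => q ^ (2 * n - 1) / (1 - q ^ (2 * n - 1)) ^ 2)
  = P 1%nat ^ 4.
Proof.
  intros q P.
  assert (Hq : (Cmod q < 1)%R) by (apply nome_Cmod_lt_1, Htau).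
  assert (Hq0 : q <> 0) by apply cexp_nz.
  set (h := qpow tau (1 / 4)).
  assert (Hh : h <> 0) by apply cexp_nz.
  assert (Eq : q = h ^ 4) by apply nome_quarter.
  assert (EP : forall k, P k = h ^ k * psi (q ^ k) ^ 2).
  { intros k. unfold P, GosperPi. rewrite qpow_quarter. reflexivity. }
  assert (ES : forall k, (1 <= k)%nat ->
    Csum1 (fun n => q ^ (k * n) / (1 - q ^ (k * n)) ^ 2) = lambert (q ^ k)).
  { intros [|k] Hk; [lia|]. apply Csum1_ext.
    - intros n _. rewrite Cpow_mult_r. reflexivity.
    - eexists. apply lambert_tends, Cmod_pow_lt_1, Hq. }
  assert (ES1 : Csum1 (fun n => q ^ n / (1 - q ^ n) ^ 2) = lambert q) by reflexivity.
  assert (EO : Csum1 (fun n => q ^ (2 * n - 1) / (1 - q ^ (2 * n - 1)) ^ 2) = lambert_odd q)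
    by reflexivity.
  assert (EO3 : Csum1 (fun n => q ^ (6 * n - 3) / (1 - q ^ (6 * n - 3)) ^ 2)
    = lambert_odd (q ^ 3)).
  { apply Csum1_ext.
    - intros n Hn. replace (6 * n - 3)%nat with (3 * (2 * n - 1))%nat by lia.
      rewrite Cpow_mult_r. reflexivity.
    - eexists. apply lambert_odd_tends, (Cmod_pow_lt_1 q 2 Hq). }
  rewrite ES1, EO, EO3, !ES, !EP by lia. clear ES1 EO EO3 ES EP P.
  replace (q ^ 1) with q by ring.
  assert (Hq2 := Cmod_pow_lt_1 q 1 Hq). assert (Hq3 := Cmod_pow_lt_1 q 2 Hq).
  assert (Hq9 := Cmod_pow_lt_1 q 8 Hq). assert (Hq30 := Cpow_nz q 3 Hq0).
  assert (Hp1 := psi_nz q Hq). assert (Hp2 := psi_nz _ Hq2).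
  assert (Hp3 := psi_nz _ Hq3). assert (Hp9 := psi_nz _ Hq9).
  assert (D1 := lambert_even_odd q Hq).
  assert (D2 := lambert_even_odd (q ^ 2) Hq2).
  assert (D3 := lambert_even_odd (q ^ 3) Hq3).
  replace ((q ^ 2) ^ 2) with (q ^ 4) in D2 by ring.
  replace ((q ^ 3) ^ 2) with (q ^ 6) in D3 by ring.
  assert (I4 := lambert_level_four q Hq0 Hq).
  assert (I2 := lambert_level_two q Hq0 Hq).
  assert (I6 := lambert_level_six q Hq0 Hq).
  assert (I6' := lambert_level_six (q ^ 3) Hq30 Hq3).
  assert (Ie := lambert_odd_cubic q Hq0 Hq).
  assert (Id := lambert_cubic q Hq0 Hq).
  assert (If := lambert_odd_fourth q Hq0 Hq).
  replace ((q ^ 3) ^ 6) with (q ^ 18) in I6' by ring.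
  replace ((q ^ 3) ^ 2) with (q ^ 6) in I6' by ring.
  replace ((q ^ 3) ^ 3) with (q ^ 9) in I6' by ring.
  (* From here on each identity is a linear combination of these relations between Lambert
     series, and [q = h^4] makes the powers of [h] agree on the side of the products. *)
  assert (E4 : (h ^ 1 * psi q ^ 2) ^ 4 / (h ^ 2 * psi (q ^ 2) ^ 2) ^ 2
    = 4 * (psi q ^ 8 / (4 * psi (q ^ 2) ^ 4))) by (field; repeat split; assumption).
  assert (E2 : (h ^ 2 * psi (q ^ 2) ^ 2) ^ 2 = (4 * q * psi (q ^ 2) ^ 4) / 4)
    by (rewrite Eq; field).
  repeat split.
  - rewrite E4, E2, <- I4, <- I2. rewrite D1, D2. field.
  (* The three terms are those of the expanded square. *)
  - transitivity ((3 * (psi q ^ 6 / (3 * psi (q ^ 3) ^ 2)) + 6 * (q * psi q ^ 2 * psi (q ^ 3) ^ 2)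
      + 9 * (q ^ 2 * psi (q ^ 3) ^ 6 / psi q ^ 2)) / 12 - 1 / 12).
    + rewrite <- I6, <- Ie, <- Id, D1, D3. field.
    + generalize (psi (q ^ 3)) Hp3 (psi q) Hp1. intros. rewrite Eq. field.
      repeat split; assumption.
  - rewrite E4, <- I4, D1, D2. field.
  - transitivity (q ^ 2 * psi (q ^ 3) ^ 6 / psi q ^ 2
      + 1 / 3 * (3 * (psi (q ^ 3) ^ 6 / (3 * psi (q ^ 9) ^ 2)) - 1)).
    + rewrite <- I6', <- Id. field.
    + generalize (psi (q ^ 3)) Hp3 (psi (q ^ 9)) Hp9 (psi q) Hp1. intros. rewrite Eq. field.
      repeat split; assumption.
  - rewrite Ie. generalize (psi (q ^ 3)) (psi q). intros. rewrite Eq. ring.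
  - rewrite If. generalize (psi q). intros. rewrite Eq. ring.
Qed.
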